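(* Let $\Gamma$ be a metric graph with underlying connected graph $G$ (that is, $\Gamma$ is the metric graph associated to $(G,l)$ for some length function $l:E(G)\to\mathbb{R}_{>0}$). Then $\operatorname{tw}(G)\leq\operatorname{gon}(\Gamma)$.
   Context: Graphs are finite and undirected, with nonempty vertex set; parallel edges are allowed, loops are not. Treewidth. A (simple) graph $H$ is chordal if it has no induced cycle of length at least $4$. A chordal extension of $G=(V,E)$ is a chordal graph $H$ on the same vertex set $V$ in which any two vertices adjacent in $G$ are adjacent. With $\omega(H)$ the maximum size of a clique in $H$, the treewidth is $\operatorname{tw}(G)=-1+\min\{\omega(H) : H \text{ is a chordal extension of } G\}$. Gonality of a metric graph. The metric graph $\Gamma$ associated to $(G,l)$ is the compact connected metric space obtained by identifying each edge $e=\{u,v\}$ with a segment of length $l(e)$ joining $u$ and $v$. A divisor on $\Gamma$ is an element $D=c_1v_1+\cdots+c_kv_k$ of the free abelian group on the points of $\Gamma$; its degree is $c_1+\cdots+c_k$, and it is effective if all coefficients are nonnegative. For a continuous piecewise linear function $f$ on $\Gamma$ with integral slopes, $\operatorname{div}(f)=\sum_{v\in\Gamma}c_v v$, where $c_v$ is the sum of the outgoing slopes of $f$ at $v$. Two divisors on $\Gamma$ are equivalent if their difference is of the form $\operatorname{div}(f)$. A divisor $D$ covers a point $s\in\Gamma$ if there is an effective divisor equivalent to $D$ with $s$ in its support. $\operatorname{gon}(\Gamma)$ is the minimum degree of a divisor that covers every point of $\Gamma$. *)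

(* Defs.v *)
From HB Require Import structures.
From mathcomp Require Import all_boot all_order all_algebra.
From mathcomp Require Import all_classical all_reals all_analysis.
From mathcomp Require Export multinomials.freeg.
Set Implicit Arguments.
Unset Strict Implicit.
Unset Printing Implicit Defensive.
Import Order.TTheory GRing.Theory Num.Theory.
Import numFieldNormedType.Exports.

Local Open Scope classical_set_scope.
Local Open Scope ring_scope.

(** The minimum of a set of integers; the value is the junk value 0 when the
    minimum does not exist. *)
Definition minimum (A : set int) : int :=
  xget 0 [set x | A x /\ (forall y, A y -> x <= y)].

(** [esrc e] and [etgt e] are the two ends of [e]; their order is only a
    reference orientation, used to parametrize the segment of [e]. *)
Record multigraph := Multigraph {
  vertex : finType;
  edge : finType;
  esrc : edge -> vertex;
  etgt : edge -> vertex;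
  loopless : forall e, esrc e != etgt e;
  vertex_nonempty : (0 < #|vertex|)%N
}.

Definition adj (G : multigraph) : rel (vertex G) := fun u v =>
  [exists e : edge G, ((esrc e == u) && (etgt e == v))
                   || ((esrc e == v) && (etgt e == u))].

Definition connected_graph (G : multigraph) : Prop :=
  forall u v : vertex G, connect (@adj G) u v.

Record simple_graph (V : finType) := SimpleGraph {
  sadj :> rel V;
  sadj_sym : symmetric sadj;
  sadj_irr : irreflexive sadj
}.

Definition induced_cycle (V : finType) (H : simple_graph V) (n : nat)
    (c : 'I_n -> V) : Prop :=
  injective c /\
  forall i j, H (c i) (c j) = (j == ordS i) || (i == ordS j).

Definition chordal (V : finType) (H : simple_graph V) : Prop :=
  forall (n : nat) (c : 'I_n -> V), (4 <= n)%N -> ~ induced_cycle H c.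

Definition chordal_extension (G : multigraph)
    (H : simple_graph (vertex G)) : Prop :=
  chordal H /\ forall u v, adj u v -> H u v.

Definition clique (V : finType) (H : simple_graph V) (A : {set V}) : bool :=
  [forall u in A, forall v in A, (u != v) ==> H u v].

Definition clique_number (V : finType) (H : simple_graph V) : nat :=
  \max_(A : {set V} | clique H A) #|A|.

Definition treewidth (G : multigraph) : int :=
  - 1 + minimum [set k | exists2 H : simple_graph (vertex G),
                           chordal_extension H & k = (clique_number H)%:Z].

Section MetricGraph.
Context {R : realType} (G : multigraph) (l : edge G -> R).

(** The quotient of the disjoint union of the vertices and of the segments
    [[0, l e]], represented
    by its points: the vertices, and the pairs [(e, t)] with [0 < t < l e]
    interior to the segment of [e]. *)
Definition mgpoint : Type :=
  (vertex G + {x : edge G * R | 0 < x.2 < l x.1})%type.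

HB.instance Definition _ := Choice.on mgpoint.

(** The quotient map from the segment [[0, l e]], with [0] sent to [esrc e] and
    [l e] to [etgt e]. It is extended by constants outside of [[0, l e]]. *)
Definition seg (e : edge G) (t : R) : mgpoint :=
  if insub (e, t) is Some x then inr x
  else inl (if t <= 0 then esrc e else etgt e).

Definition pl_integral (g : R -> R) (a b : R) : Prop :=
  exists s : seq R, itv_partition a b s /\
    forall i, (i < size s)%N ->
      let t0 := nth b (a :: s) i in
      let t1 := nth b (a :: s) i.+1 in
      exists k : int, forall t, t0 <= t <= t1 -> g t = g t0 + k%:~R * (t - t0).

(** By the universal property of the quotient, [f] is continuous on the metric
    graph iff it is so on each closed segment. *)
Definition pl_function (f : mgpoint -> R) : Prop :=
  forall e, {within `[0, l e], continuous (f \o seg e)} /\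
            pl_integral (f \o seg e) 0 (l e).

(** The outgoing slope of [f] at the point at abscissa [t] of the segment of
    [e], towards [etgt e] when [d = 1] and towards [esrc e] when [d = -1]. *)
Definition slope (f : mgpoint -> R) (e : edge G) (t d : R) : R :=
  lim ((f (seg e (t + d * h)) - f (seg e t)) / h @[h --> 0^'+]).

Definition sum_outgoing_slopes (f : mgpoint -> R) (p : mgpoint) : R :=
  match p with
  | inl v => \sum_(e | esrc e == v) slope f e 0 1
             + \sum_(e | etgt e == v) slope f e (l e) (-1)
  | inr x => slope f (val x).1 (val x).2 1 + slope f (val x).1 (val x).2 (-1)
  end.

Local Notation divisor := {freeg mgpoint}.

Definition is_div (f : mgpoint -> R) (D : divisor) : Prop :=
  forall p, (coeff p D)%:~R = sum_outgoing_slopes f p.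

Definition equivalent (D D' : divisor) : Prop :=
  exists2 f, pl_function f & is_div f (D - D').

Definition effective (D : divisor) : Prop := forall p, 0 <= coeff p D.

Definition covers (D : divisor) (s : mgpoint) : Prop :=
  exists D' : divisor, [/\ effective D', equivalent D' D & s \in dom D'].

Definition gonality : int :=
  minimum [set k | exists2 D : divisor, (forall s, covers D s) & k = deg D].

End MetricGraph.

(* Main.v *)
Require Import Defs.
From mathcomp Require Import all_boot all_order all_algebra.
From mathcomp Require Import zify.
Set Implicit Arguments.
Unset Strict Implicit.
Unset Printing Implicit Defensive.
Import Order.TTheory GRing.Theory Num.Theory.
Local Open Scope ring_scope.

(** Let [D] be a divisor of degree [k] covering every point. The effective
    divisors equivalent to [D] are the [D + div g], and the set of these [g] is
    closed under maxima and under adding constants. Read an effective divisor as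
    [k] cops chasing a robber confined to a set [C] of vertices, such that every
    edge leaving [C] carries a chip, in its interior or at its outer end.

    If some vertex of [C] carries a chip, it is removed from [C]. Otherwise choose
    [g'] such that [D + div g'] has a chip on [C], and let [s] be the maximum of
    [g' - g] on [C]. Decreasing [r] to [s], the divisors [D + div max(g', g + r)]
    push the chips along the edges towards [C] without ever releasing [C]: a point
    where [g'] and [g + r] meet with different slopes carries a chip. At [r = s],
    either a chip has reached [C], or the edges joining the vertices of [C] where
    [g' - g = s] to the other vertices of [C] all carry a chip in their interior,
    and [C] falls apart into two smaller guarded sets.

    Eliminating the vertices in the order in which they are caught yields a chordal
    extension: each new vertex is attached to a clique with at most [k] vertices,
    one end being chosen on each of the edges leaving [C]. *)

(** * Chordal extensions from guarding configurations *)

Section SimplicialExtension.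
Variables (V : finType).
Implicit Types (K : simple_graph V) (A S T : {set V}).

(** Removing [v] from [T] keeps the relation irreflexive for every [T]. *)
Definition simplicial_rel K v T : rel V := fun u w =>
  [|| K u w, (u == v) && (w \in T :\ v) | (w == v) && (u \in T :\ v)].

Lemma simplicial_rel_sym K v T : symmetric (simplicial_rel K v T).
Proof. by move=> u w; rewrite /simplicial_rel sadj_sym [X in _ || X]orbC. Qed.

Lemma simplicial_rel_irr K v T : irreflexive (simplicial_rel K v T).
Proof. by move=> u; rewrite /simplicial_rel sadj_irr !inE; case: eqP. Qed.

Definition add_simplicial K v T :=
  SimpleGraph (simplicial_rel_sym K v T) (simplicial_rel_irr K v T).

Lemma cliqueP K (B : {set V}) :
  reflect {in B &, forall u w, u != w -> K u w} (clique K B).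
Proof.
apply: (iffP forall_inP) => [h u w uB wB uw|h u uB].
  by move/forall_inP: (h u uB) => /(_ w wB); rewrite uw.
by apply/forall_inP => w wB; apply/implyP => uw; exact: h.
Qed.

Lemma clique_sub K (A B : {set V}) : A \subset B -> clique K B -> clique K A.
Proof.
move=> /subsetP AB /cliqueP cl; apply/cliqueP => u w uA wA.
by apply: cl; exact: AB.
Qed.

(** [K] lives on the vertices of [A], those outside of [A] being isolated. *)
Definition chordal_on (k : nat) A K :=
  [/\ chordal K, forall u w, K u w -> u \in A
    & forall B : {set V}, clique K B -> (#|B| <= k.+1)%N].

(** An induced cycle avoiding [v] is already one of [K]. On a cycle through [v], the two neighbours
    of [v] lie in the clique [T], hence are adjacent, which gives a chord as the length is at least
    4. *)
Lemma chordal_add_simplicial K A v T : (forall u w, K u w -> u \in A) ->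
  v \notin A -> clique K T -> chordal K -> chordal (add_simplicial K v T).
Proof.
move=> KA vA /cliqueP clT chK n c n4 [injc adjc].
have n0 : (0 < n)%N by apply: leq_trans n4.
have Kv u : K v u = false by apply/negP => /KA; apply/negP.
have Kv' u : K u v = false by rewrite sadj_sym.
case: (pickP (fun i => c i == v)) => [i /eqP civ|nov].
  pose p := ord_pred i; pose q := ordS i.
  have pi : ordS p = i by rewrite ord_predK.
  have valS (j : 'I_n) : val (ordS j) = if j.+1 == n then 0%N else j.+1.
    rewrite /=; case: eqP => [->|/eqP jn]; first by rewrite modnn.
    by rewrite modn_small // ltn_neqAle jn ltn_ord.
  have inT j : (j == ordS i) || (i == ordS j) -> c j \in T :\ v.
    rewrite -adjc civ /= /simplicial_rel Kv eqxx /=.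
    by case/orP => // /andP[/eqP ->]; rewrite !inE eqxx.
  have /setD1P[qv qT] : c q \in T :\ v by apply: inT; rewrite eqxx.
  have /setD1P[pv pT] : c p \in T :\ v by apply: inT; rewrite pi eqxx orbT.
  have ip : val i = if p.+1 == n then 0%N else p.+1 by rewrite -valS pi.
  have Sq : val q = if i.+1 == n then 0%N else i.+1 by rewrite -valS.
  have pq : p != q.
    rewrite -val_eqE /= -[(i.+1 %% n)%N]/(val q) -[((i + n).-1 %% n)%N]/(val p).
    move: ip Sq (ltn_ord p) (ltn_ord q) (ltn_ord i).
    by case: eqP; case: eqP => /=; lia.
  have cpq : c p != c q by rewrite (inj_eq injc).
  have := adjc p q; rewrite /= /simplicial_rel clT //= pi.
  move/esym/orP => -[]; rewrite -val_eqE.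
    move=> /eqP; move: ip Sq (ltn_ord p) (ltn_ord q) (ltn_ord i).
    by case: eqP; case: eqP => /=; lia.
  rewrite valS => /eqP; move: ip Sq (ltn_ord p) (ltn_ord q) (ltn_ord i).
  by case: eqP; case: eqP; case: eqP => /=; lia.
apply: (chK n c n4); split=> // i j; rewrite -adjc /= /simplicial_rel.
by rewrite !nov /= !orbF.
Qed.

(** A clique containing [v] lies in [v |: T], which has at most [k.+1] elements; any other clique is
    a clique of [K]. *)
Lemma chordal_on_add k K A v T : v \notin A -> clique K T -> T \subset A ->
  (#|T| <= k)%N -> chordal_on k A K ->
  chordal_on k (v |: A) (add_simplicial K v T).
Proof.
move=> vA clT TA Tk [chK KA clK].
have vT : v \notin T by apply: contra vA; exact: (subsetP TA).
have Kv u : K v u = false by apply/negP => /KA; apply/negP.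
split.
- exact: (chordal_add_simplicial KA).
- move=> u w /or3P[/KA uA|/andP[/eqP-> _]|/andP[_]]; rewrite !inE ?uA ?eqxx ?orbT //.
  by move=> /andP[_ /(subsetP TA) ->]; rewrite orbT.
- move=> B /cliqueP clB; have [vB|vB] := boolP (v \in B).
    rewrite (cardsD1 v) vB ltnS; apply: leq_trans Tk; apply: subset_leq_card.
    apply/subsetP => u /setD1P[uv uB]; have := clB v u vB uB.
    rewrite eq_sym uv => /(_ isT) /=; rewrite /simplicial_rel Kv eqxx /= (negbTE uv).
    by rewrite orbF !inE uv.
  apply: clK; apply/cliqueP => u w uB wB uw; have := clB u w uB wB uw.
  rewrite /= /simplicial_rel.
  by case/or3P => // /andP[/eqP] vv; move: uB wB; rewrite vv (negbTE vB).
Qed.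

Lemma clique_add_simplicial K v T : clique K T ->
  clique (add_simplicial K v T) (v |: T).
Proof.
move=> /cliqueP clT; apply/cliqueP => u w.
rewrite !inE /= /simplicial_rel !inE.
have [->|uv] := eqVneq u v; have [->|wv] := eqVneq w v => //=.
- by move=> _ ->; rewrite orbT.
- by move=> -> _; rewrite orbT.
- by move=> uT wT uw; rewrite clT.
Qed.

(** Enlarges a bag [S] by [T]. The vertices of [T] outside [S] are new by [A :&: T \subset S]; they
    enter one at a time, each joined to [S] and to those already added. *)
Lemma chordal_on_addset k K A S T : chordal_on k A K -> clique K S ->
  S \subset A -> A :&: T \subset S -> (#|S :|: T| <= k.+1)%N ->
  exists K', [/\ chordal_on k (A :|: T) K', subrel K K' & clique K' (S :|: T)].
Proof.
move=> gK clS SA; have [m] := ubnP #|T|; elim: m T => // m IH T Tm ATS STk.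
have [TS|/subsetPn[w wT wS]] := boolP (T \subset S).
  exists K; rewrite (setUidPl TS) (setUidPl (subset_trans TS SA)).
  by split.
have wA : w \notin A by apply: contra wS => wA; rewrite (subsetP ATS)// inE wA.
have cT : #|T| = #|T :\ w|.+1 by rewrite (cardsD1 w T) wT.
have cST : #|S :|: T| = #|S :|: T :\ w|.+1.
  rewrite (cardsD1 w (S :|: T)) !inE wT orbT add1n setDUl.
  by congr (#|_ :|: _|.+1); apply/setDidPl; rewrite disjoint_sym disjoints1.
have [|||K' [gK' KK' clK']] := IH (T :\ w).
- by rewrite cT in Tm.
- by apply: subset_trans ATS; apply: setIS; exact: subD1set.
- by apply: ltnW; rewrite -cST.
have unw (X : {set V}) : w |: (X :|: T :\ w) = X :|: T.
  by rewrite setUCA setD1K.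
exists (add_simplicial K' w (S :|: T :\ w)); split.
- rewrite -(unw A); apply: chordal_on_add => //.
  + by rewrite !inE (negbTE wA) eqxx.
  + exact: setSU.
  + by rewrite -ltnS -cST.
- by move=> u v /KK' Kuv; rewrite /= /simplicial_rel Kuv.
- by rewrite -(unw S); exact: clique_add_simplicial.
Qed.

End SimplicialExtension.

(** * Vertex sets guarded by chips, and the elimination of their vertices *)

Section Territories.
Variables (G : multigraph) (k : nat).
Local Notation V := (vertex G).
Local Notation E := (edge G).
Implicit Types (C W : {set V}) (phi psi : E -> V) (e : E).

Definition edge_cut C := [set e | (esrc e \in C) (+) (etgt e \in C)].
(** On an edge of the cut this is the end lying in [C]; on any other edge it is a default value. *)
Definition inner C e := if esrc e \in C then esrc e else etgt e.
Definition labelling phi := forall e, phi e \in [set esrc e; etgt e].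

Lemma label_inner C phi e : labelling phi -> e \in edge_cut C -> phi e \in C ->
  phi e = inner C e.
Proof.
move=> /(_ e); rewrite !inE /inner => /orP[]/eqP->; first by move=> _ ->.
by move=> h tC; move: h; rewrite tC; case: ifP.
Qed.

Lemma inner_in C e : e \in edge_cut C -> inner C e \in C.
Proof. by rewrite inE /inner; case: ifP => //= _ ->. Qed.

Lemma inner_end C e : inner C e \in [set esrc e; etgt e].
Proof. by rewrite /inner; case: ifP; rewrite !inE eqxx ?orbT. Qed.

(** A configuration of chips: the vertices holding a chip and the edges holding
    a chip in their interior. *)
Definition config := ({set V} * {set E})%type.
Implicit Type c : config.

Definition guards c (F : {set E}) phi :=
  forall e, e \in F -> (phi e \in c.1) || (e \in c.2).

(** Each label carries a chip itself or is the label of an edge with an interior chip. This bounds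
    the bags by the number of chips. *)
Lemma guards_card c F phi : guards c F phi ->
  (#|phi @: F| <= #|c.1| + #|c.2|)%N.
Proof.
move=> gF; apply: (@leq_trans #|c.1 :|: phi @: c.2|).
  apply: subset_leq_card; apply/subsetP => _ /imsetP[e /gF h ->].
  by case/orP: h => h; rewrite inE ?h // imset_f ?orbT.
rewrite cardsU (leq_trans (leq_subr _ _)) // leq_add2l.
exact: leq_imset_card.
Qed.

(** The graphs [K] and [K'] are the chordal extensions before and after the
    elimination of the vertices of [C]; [phi @: edge_cut C] is the bag separating
    [C] from what is already built. Labelling an edge by its inner end means
    that this end has already entered the bag. *)
Definition extendable C phi := forall A (K : simple_graph V),
  chordal_on k A K -> clique K (phi @: edge_cut C) -> phi @: edge_cut C \subset A ->
  A :&: C \subset phi @: edge_cut C ->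
  exists K' : simple_graph V,
    [/\ chordal_on k (A :|: C) K', subrel K K',
        forall e, esrc e \in C -> etgt e \in C -> K' (esrc e) (etgt e)
      & forall e, e \in edge_cut C -> phi e != inner C e -> K' (phi e) (inner C e)].

Lemma extendable_ext C phi psi : {in edge_cut C, phi =1 psi} ->
  extendable C phi -> extendable C psi.
Proof.
move=> eq ext A K; rewrite -(eq_in_imset eq) => g cl s i.
have [K' [h1 h2 h3 h4]] := ext A K g cl s i; exists K'; split=> // e eC.
by rewrite -eq //; exact: h4.
Qed.

(** Only labels of edges with inner end [y] change, and they become [y]. So the bag of [psi] lies in
    the bag of [phi] plus [y], which can be made a clique on at most [k.+1] vertices; adjoining
    several vertices at once could exceed this bound. *)
Lemma extendable_relabel_at C phi psi y : labelling phi -> y \in C ->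
  (#|phi @: edge_cut C| <= k)%N ->
  {in edge_cut C, forall e, psi e = if inner C e == y then psi e else phi e} ->
  {in edge_cut C, forall e, psi e = phi e \/ psi e = inner C e} ->
  extendable C psi -> extendable C phi.
Proof.
move=> lphi yC ck psiE psiI ext A K g cl s i.
have psi_cases e : e \in edge_cut C ->
    psi e = phi e \/ (inner C e = y /\ psi e = y).
  move=> eC; case: (psiI _ eC) => [->|h]; first by left.
  have := psiE _ eC; case: eqP => [iy _|_ ->]; last by left.
  by right; rewrite h iy.
have [same|/forall_inPn[e0 e0C ne0]] :=
  boolP [forall e in edge_cut C, psi e == phi e].
  apply: (extendable_ext _ ext) => // e eC.
  by apply/eqP; exact: (forall_inP same).
(* Some label changes, so [y] is in the new bag; [extendable] asks this of every vertex of [C]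
   already built, and [y] is about to be built. *)
have py : y \in psi @: edge_cut C.
  case: (psi_cases e0 e0C) => [h|[_ h]]; first by rewrite h eqxx in ne0.
  by apply/imsetP; exists e0.
have sub : psi @: edge_cut C \subset phi @: edge_cut C :|: [set y].
  apply/subsetP => _ /imsetP[e eC ->].
  by case: (psi_cases e eC) => [->|[_ ->]]; rewrite !inE ?imset_f ?eqxx ?orbT.
have [||K1 [g1 K1K cl1]] := @chordal_on_addset _ k K A (phi @: edge_cut C) [set y] g cl s.
- by apply: subset_trans i; apply: setIS; rewrite sub1set.
- by rewrite setUC cardsU1; case: (y \notin _); rewrite ?ltnS ?leqW.
have [|||K' [g' K'K1 cov cutc]] := ext (A :|: [set y]) K1 g1.
- exact: clique_sub cl1.
- apply: subset_trans sub _; exact: setSU.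
- apply/subsetP => u; rewrite !inE => /andP[/orP[uA uC|/eqP -> //]].
  have : u \in phi @: edge_cut C by rewrite (subsetP i)// inE uA.
  case/imsetP => e eC ue; case: (psi_cases e eC) => [h|[iy h]].
    by rewrite ue -h imset_f.
  by rewrite ue (label_inner lphi eC) -?ue // iy.
exists K'; split.
- have yyC : [set y] \subset C by rewrite sub1set.
  by move: g'; rewrite -setUA (setUidPr yyC).
- by move=> u w /K1K /K'K1.
- exact: cov.
- move=> e eC ne; case: (psi_cases e eC) => [h|[iy h]].
    by rewrite -h; apply: cutc; rewrite // h.
  apply: K'K1; rewrite iy; move/cliqueP: cl1; apply; rewrite ?inE ?imset_f ?eqxx ?orbT //.
  by rewrite -iy.
Qed.

(** The relabelling is done one inner end at a time. All intermediate labellings [mix ys] are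
    guarded by the same chips, so every intermediate bag has at most [k] vertices. *)
Lemma extendable_relabel C c phi psi : labelling phi -> labelling psi ->
  (#|c.1| + #|c.2| <= k)%N -> guards c (edge_cut C) phi -> guards c (edge_cut C) psi ->
  {in edge_cut C, forall e, psi e = phi e \/ psi e = inner C e} ->
  extendable C psi -> extendable C phi.
Proof.
move=> lphi lpsi ck gphi gpsi psiI ext.
pose mix (ys : seq V) e := if inner C e \in ys then psi e else phi e.
have lmix ys : labelling (mix ys) by move=> e; rewrite /mix; case: ifP.
have gmix ys : guards c (edge_cut C) (mix ys).
  by move=> e eC; rewrite /mix; case: ifP => _; [exact: gpsi|exact: gphi].
have : extendable C (mix (enum C)).
  apply: extendable_ext ext => e eC.
  by rewrite /mix mem_enum inner_in.
have : {subset enum C <= C} by move=> y; rewrite mem_enum.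
elim: (enum C) => [_|y ys IH ysC ext']; first exact: extendable_ext.
apply: IH => [z zys|]; first by apply: ysC; rewrite inE zys orbT.
apply: (extendable_relabel_at (y := y) _ _ _ _ _ ext') => //.
- by apply: ysC; rewrite inE eqxx.
- exact: leq_trans (guards_card (gmix ys)) ck.
- by move=> e eC; rewrite /mix inE; case: eqP.
- move=> e eC; rewrite /mix inE; have := psiI e eC.
  case: eqP => //= _; case: ifP => // _; by [left|].
Qed.

Lemma extendable0 phi : extendable set0 phi.
Proof.
move=> A K g cl s i; exists K; split => //; first by rewrite setU0.
- by move=> e; rewrite inE.
- by move=> e; rewrite !inE.
Qed.

(** The caught vertex [w] joins the bag, a clique on at most [k.+1] vertices. This covers the edges
    from [w] to the outside of [C]. The edges from [w] to the rest of [C] become cut edges labelled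
    by [w], so they are covered when their other end is eliminated. *)
Lemma extendable_eliminate C c phi w : labelling phi -> w \in C ->
  (#|c.1| + #|c.2| <= k)%N -> guards c (edge_cut C) phi ->
  extendable (C :\ w) (fun e => if w \in [set esrc e; etgt e] then w else phi e) ->
  extendable C phi.
Proof.
set psi := (fun e => _) => lphi wC ck gphi ext A K g cl s i.
have [||K1 [g1 K1K cl1]] := @chordal_on_addset _ k K A (phi @: edge_cut C) [set w] g cl s.
- by apply: subset_trans i; apply: setIS; rewrite sub1set.
- have := leq_trans (guards_card gphi) ck.
  by rewrite setUC cardsU1; case: (w \notin _); rewrite ?ltnS // => /leqW.
have cutD e : w \notin [set esrc e; etgt e] ->
    (e \in edge_cut (C :\ w)) = (e \in edge_cut C).
  by rewrite !inE negb_or ![w == _]eq_sym => /andP[-> ->].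
have innerD e : w \notin [set esrc e; etgt e] -> inner (C :\ w) e = inner C e.
  by rewrite !inE negb_or ![w == _]eq_sym /inner !inE => /andP[-> _].
have sub : psi @: edge_cut (C :\ w) \subset phi @: edge_cut C :|: [set w].
  apply/subsetP => _ /imsetP[e eC ->]; rewrite /psi; case: ifPn => [|nw].
    by rewrite !inE eqxx orbT.
  by rewrite inE imset_f //  -cutD.
have [|||K' [g' K'K1 cov cutc]] := ext (A :|: [set w]) K1 g1.
- exact: clique_sub cl1.
- apply: subset_trans sub _; exact: setSU.
- apply/subsetP => u; rewrite !inE => /andP[/orP[uA|-> //]] /andP[uw uC].
  have : u \in phi @: edge_cut C by rewrite (subsetP i)// inE uA.
  (* The bag vertex [u] is the inner end of [e], and the other end is outside [C]. Hence [w] is not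
     an end of [e], whose label is kept. *)
  case/imsetP => e eC ue; have nw : w \notin [set esrc e; etgt e].
    have ui : u = inner C e by rewrite ue; apply: label_inner; rewrite -?ue.
    move: eC uw; rewrite ui !inE /inner; case: ifP => /= sC tC uw;
    rewrite negb_or ![w == _]eq_sym uw ?andbT //=.
      by apply/negP => /eqP h; rewrite h wC in tC.
    by apply/negP => /eqP h; rewrite h wC in sC.
  by apply/imsetP; exists e; rewrite ?cutD // /psi (negbTE nw).
exists K'; split.
- by move: g'; rewrite -setUA setD1K.
- by move=> u v /K1K /K'K1.
- move=> e sC tC.
  have [es|ws] := eqVneq (esrc e) w; have [et|wt] := eqVneq (etgt e) w.
  + by have := loopless e; rewrite es et eqxx.
  + have eC : e \in edge_cut (C :\ w) by rewrite !inE es eqxx /= tC wt.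
    have := cutc e eC; rewrite /psi /inner !inE es eqxx /= eq_sym.
    by apply.
  + have eC : e \in edge_cut (C :\ w) by rewrite !inE et eqxx /= sC ws.
    have := cutc e eC; rewrite /psi /inner !inE et eqxx orbT sC ws /= eq_sym.
    by rewrite sadj_sym; apply.
  + by apply: cov; rewrite !inE ?ws ?wt.
- move=> e eC ne; have [nw|nw] := boolP (w \in [set esrc e; etgt e]).
    have iw : inner C e = w.
      move: nw eC; rewrite !inE /inner => /orP[/eqP <-|/eqP <-]; first by rewrite wC.
      by rewrite wC; case: ifP.
    apply: K'K1; rewrite iw; move/cliqueP: cl1; apply;
      rewrite ?inE ?imset_f ?eqxx ?orbT //.
    by rewrite -iw.
  have := cutc e; rewrite cutD // innerD // /psi (negbTE nw).
  by apply.
Qed.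

(** The chips on the edges between [W] and [C :\: W] separate both parts; in
    both of them such an edge is labelled by its end in [W]. *)
Lemma extendable_split C W c phi : labelling phi -> W \subset C ->
  (#|c.1| + #|c.2| <= k)%N -> guards c (edge_cut C) phi ->
  edge_cut W :&: edge_cut (C :\: W) \subset c.2 ->
  let psi e := if e \in edge_cut W :&: edge_cut (C :\: W) then inner W e else phi e in
  extendable W psi -> extendable (C :\: W) psi -> extendable C phi.
Proof.
move=> lphi WC ck gphi sepW psi extW extD A K g cl s i.
have WC' u : u \in W -> u \in C by exact: (subsetP WC).
have WCb u : (u \in W) ==> (u \in C) by apply/implyP; exact: WC'.
have cutU : edge_cut C :|: (edge_cut W :&: edge_cut (C :\: W)) =
    edge_cut W :|: edge_cut (C :\: W).
  apply/setP => e; rewrite !inE; move: (WCb (esrc e)) (WCb (etgt e)).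
  by do 4 case: (_ \in _).
have cutI e : e \in edge_cut C -> e \notin edge_cut W :&: edge_cut (C :\: W).
  rewrite !inE; move: (WCb (esrc e)) (WCb (etgt e)).
  by do 4 case: (_ \in _).
have psiC e : e \in edge_cut C -> psi e = phi e.
  by move=> /cutI; rewrite /psi => /negbTE ->.
set X := edge_cut W :&: edge_cut (C :\: W).
have psiX e : e \in X -> psi e = inner W e by rewrite /psi => ->.
pose T := psi @: X.
have TW : T \subset W.
  apply/subsetP => _ /imsetP[e eX ->]; rewrite psiX //.
  by move: eX; rewrite inE => /andP[/inner_in].
(* The chips of [c] guard the cuts of both parts together under [psi], since the separating edges
   carry interior chips. The joint bag therefore has at most [k] vertices, and it contains the bags
   of both parts. *)
have ST : phi @: edge_cut C :|: T = psi @: (edge_cut W :|: edge_cut (C :\: W)).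
  by rewrite -cutU imsetU -(eq_in_imset psiC).
have [|| K1 [g1 K1K cl1]] := @chordal_on_addset _ k K A (phi @: edge_cut C) T g cl s.
- by apply: subset_trans i; apply: setIS; exact: subset_trans WC.
- rewrite ST; apply: leqW; apply: leq_trans ck; apply: guards_card => e.
  rewrite -cutU inE => /orP[eC|eX]; first by rewrite psiC // gphi.
  by rewrite (subsetP sepW) // orbT.
have STA : phi @: edge_cut C :|: T \subset A :|: T by exact: setSU.
have inC u : u \in A -> u \in C ->
    exists2 e, e \in edge_cut C & u = psi e /\ u = inner C e.
  move=> uA uC; have : u \in phi @: edge_cut C by rewrite (subsetP i)// inE uA.
  case/imsetP => e eC ue; exists e => //; split; first by rewrite psiC.
  by rewrite ue; apply: label_inner => //; rewrite -ue.
have [|||K2 [g2 K2K1 cov2 cut2]] := extW (A :|: T) K1 g1.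
- by apply: clique_sub cl1; rewrite ST imsetS // subsetUl.
- by apply: subset_trans STA; rewrite ST imsetS // subsetUl.
- apply/subsetP => u; rewrite !inE => /andP[/orP[uA|uT] uW].
    have [e eC [ue ui]] := inC u uA (WC' _ uW); rewrite ue imset_f // !inE.
    move: eC uW; rewrite ui /inner !inE.
    move: (WCb (esrc e)) (WCb (etgt e)).
    by case: (esrc e \in C); case: (etgt e \in C) => /=;
      case: (esrc e \in W); case: (etgt e \in W).
  by move: uT; apply/subsetP; apply: imsetS; exact: subsetIl.
have [|||K3 [g3 K3K2 cov3 cut3]] := extD (A :|: T :|: W) K2 g2.
- apply/cliqueP => u v uS vS uv; apply: K2K1; move/cliqueP: cl1; apply => //.
    by move: uS; rewrite ST; apply/subsetP; apply: imsetS; exact: subsetUr.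
  by move: vS; rewrite ST; apply/subsetP; apply: imsetS; exact: subsetUr.
- apply: (subset_trans _ (subsetUl _ _)); apply: subset_trans STA.
  by rewrite ST imsetS // subsetUr.
- apply/subsetP => u; rewrite !inE => /andP[/orP[/orP[uA|/(subsetP TW) -> //]|-> //]].
  move=> /andP[uW uC].
  have [e eC [ue ui]] := inC u uA uC; rewrite ue imset_f // !inE.
  move: eC uW; rewrite ui /inner !inE.
  move: (WCb (esrc e)) (WCb (etgt e)).
    by case: (esrc e \in C); case: (etgt e \in C) => /=;
      case: (esrc e \in W); case: (etgt e \in W).
exists K3; split.
- move: g3; congr (chordal_on k _ K3); apply/setP => u; rewrite !inE.
  have : (u \in T) ==> (u \in W) by apply/implyP; exact: (subsetP TW).
  by move: (WCb u); case: (u \in C); case: (u \in W); case: (u \in T);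
    rewrite ?orbT ?orbF.
- by move=> u v /K1K /K2K1 /K3K2.
- move=> e sC tC.
  have [es|ws] := boolP (esrc e \in W); have [et|wt] := boolP (etgt e \in W).
  + by apply: K3K2; exact: cov2.
  + have eX : e \in X by rewrite !inE es (negbTE wt) sC tC.
    have eD : e \in edge_cut (C :\: W) by move: eX; rewrite inE => /andP[].
    have := cut3 e eD; rewrite psiX //.
    have -> : inner W e = esrc e by rewrite /inner es.
    have -> : inner (C :\: W) e = etgt e by rewrite /inner inE es.
    by apply; exact: loopless.
  + have eX : e \in X by rewrite !inE et (negbTE ws) sC tC.
    have eD : e \in edge_cut (C :\: W) by move: eX; rewrite inE => /andP[].
    have := cut3 e eD; rewrite psiX //.
    have -> : inner W e = etgt e by rewrite /inner (negbTE ws).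
    have -> : inner (C :\: W) e = esrc e by rewrite /inner inE ws sC.
    by rewrite sadj_sym eq_sym; apply; exact: loopless.
  + by apply: cov3; rewrite inE ?ws ?wt.
- move=> e eC; rewrite -psiC //.
  have [iW|iW] := boolP (inner C e \in W).
    have := cut2 e; suff [-> -> h] : inner W e = inner C e /\ e \in edge_cut W.
      by move=> ne; apply: K3K2; exact: h.
    move: eC iW; rewrite /inner !inE.
    move: (WCb (esrc e)) (WCb (etgt e)).
    by case: (esrc e \in C); case: (etgt e \in C) => /=;
      case: (esrc e \in W); case: (etgt e \in W).
  have := cut3 e.
  suff [-> -> h] : inner (C :\: W) e = inner C e /\ e \in edge_cut (C :\: W).
    by move=> ne; exact: h.
  move: eC iW; rewrite /inner !inE.
  move: (WCb (esrc e)) (WCb (etgt e)).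
    by case: (esrc e \in C); case: (etgt e \in C) => /=;
      case: (esrc e \in W); case: (etgt e \in W).
Qed.


(** * The pursuit, for an abstract family of configurations *)

Section Pursuit.
Variable F : config -> Prop.
Hypothesis F_card : forall c, F c -> (#|c.1| + #|c.2| <= k)%N.
(** One sweep of the chips. The configuration [c1] guards under both the old and the new labels, as
    [extendable_relabel] requires; [c2] is the end of the sweep, where a chip is on [C] or [C] falls
    apart. *)
Hypothesis F_move : forall c C phi, F c -> C != set0 -> c.1 :&: C = set0 ->
  labelling phi -> guards c (edge_cut C) phi ->
  exists c1 c2 psi,
    [/\ F c1, F c2, labelling psi
      & {in edge_cut C, forall e, psi e = phi e \/ psi e = inner C e}] /\
    [/\ guards c1 (edge_cut C) phi, guards c1 (edge_cut C) psi, guards c2 (edge_cut C) psi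
      & c2.1 :&: C = set0 -> exists W,
          [/\ W \proper C, W != set0 & edge_cut W :&: edge_cut (C :\: W) \subset c2.2]].

(** Induction on the size of [C]. A chip on [C] allows an elimination; otherwise a sweep relabels
    the cut through [c1], and then [c2] allows either an elimination or a splitting into two smaller
    sets. *)
Lemma guarded_extendable C phi c :
  F c -> labelling phi -> guards c (edge_cut C) phi -> extendable C phi.
Proof.
have [m] := ubnP #|C|; elim: m C phi c => // m IH C phi c Cm Fc lphi gphi.
have elim_chip c' phi' w : F c' -> labelling phi' -> guards c' (edge_cut C) phi' ->
    w \in c'.1 -> w \in C -> extendable C phi'.
  move=> Fc' lphi' gphi' wc wC.
  apply: (extendable_eliminate lphi' wC (F_card Fc') gphi').
  apply: (IH _ _ c') => //; first by rewrite (cardsD1 w C) wC in Cm.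
    by move=> e; case: ifP => // _; exact: lphi'.
  move=> e; case: ifPn => [we _|we]; first by rewrite wc.
  rewrite !inE negb_or ![w == _]eq_sym in we *.
  by case/andP: we => -> -> eC; apply: gphi'; rewrite inE.
have [->|C0] := eqVneq C set0; first exact: extendable0.
have [dis|/set0Pn[w /setIP[wc wC]]] := eqVneq (c.1 :&: C) set0; last first.
  exact: (elim_chip c _ w).
have [c1 [c2 [psi [[F1 F2 lpsi psiI] [g1 g1' g2 split2]]]]] :=
  F_move Fc C0 dis lphi gphi.
apply: (extendable_relabel lphi lpsi (F_card F1) g1 g1' psiI).
have [dis2|/set0Pn[w /setIP[wc wC]]] := eqVneq (c2.1 :&: C) set0; last first.
  exact: (elim_chip c2 _ w).
have [W [WC W0 sepW]] := split2 dis2.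
have WsC := proper_sub WC.
have lab2 : labelling (fun e =>
    if e \in edge_cut W :&: edge_cut (C :\: W) then inner W e else psi e).
  by move=> e; case: ifP => // _; exact: inner_end.
have g2' (D : {set V}) :
    edge_cut D :\: (edge_cut W :&: edge_cut (C :\: W)) \subset edge_cut C ->
    guards c2 (edge_cut D) (fun e =>
      if e \in edge_cut W :&: edge_cut (C :\: W) then inner W e else psi e).
  move=> /subsetP sub e eD; case: ifPn => eX.
    by rewrite (subsetP sepW _ eX) orbT.
  by apply: g2; apply: sub; rewrite !in_setD eX.
have WCb u : (u \in W) ==> (u \in C) by apply/implyP; exact: (subsetP WsC).
apply: (extendable_split lpsi WsC (F_card F2) g2 sepW); apply: (IH _ _ c2) => //.
- by rewrite ltnS in Cm; exact: leq_trans (proper_card WC) Cm.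
- apply: g2'; apply/subsetP => e; rewrite !inE.
  by move: (WCb (esrc e)) (WCb (etgt e)); do 4 case: (_ \in _).
- have := cardsID W C; rewrite (setIidPr WsC).
  by move: W0; rewrite -card_gt0; lia.
- apply: g2'; apply/subsetP => e; rewrite !inE.
  by move: (WCb (esrc e)) (WCb (etgt e)); do 4 case: (_ \in _).
Qed.

(** The pursuit starts with the whole vertex set, whose cut is empty: nothing needs guarding, and
    the edgeless graph is extended from an empty bag. *)
Lemma pursuit_chordal_extension c : F c ->
  exists2 H : simple_graph V, chordal_extension H & (clique_number H <= k.+1)%N.
Proof.
move=> Fc.
have cT : edge_cut setT = set0 by apply/setP => e; rewrite !inE.
pose phi (e : E) := esrc e.
have lphi : labelling phi by move=> e; rewrite !inE eqxx.
have ext : extendable setT phi.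
  by apply: (guarded_extendable Fc lphi) => e; rewrite cT inE.
pose r0 : rel V := fun _ _ => false.
have r0s : symmetric r0 by [].
have r0i : irreflexive r0 by [].
have [||||H [gH _ cov _]] := ext set0 (SimpleGraph r0s r0i);
  rewrite ?cT ?imset0 ?sub0set //.
- split=> //.
    move=> n d n4 [_ /(_ (Ordinal (leq_trans (isT : 0 < 4)%N n4))
                         (ordS (Ordinal (leq_trans (isT : 0 < 4)%N n4))))].
    by rewrite eqxx.
  move=> B /cliqueP clB; rewrite leqNgt; apply/negP => B1.
  have /card_gt1P[u [w [uB wB uw]]] : (1 < #|B|)%N by apply: leq_ltn_trans B1.
  by have := clB u w uB wB uw.
- by apply/cliqueP => u; rewrite inE.
- by apply/subsetP => u; rewrite !inE.
have [chH _ clH] := gH; exists H.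
  split=> // u w /existsP[e /orP[] /andP[/eqP <- /eqP <-]].
    by apply: cov; rewrite inE.
  by rewrite sadj_sym; apply: cov; rewrite inE.
by apply/bigmax_leqP => B; exact: clH.
Qed.

End Pursuit.
End Territories.

From mathcomp Require Import all_classical all_reals all_analysis.
From mathcomp Require Import ring lra.
Import numFieldNormedType.Exports.
Local Open Scope ring_scope.

(** * Locally affine functions *)

Section LocallyAffine.
Variable R : realType.
Implicit Types (h : R -> R) (t d k a b : R).

(** A one-sided germ: [d] is meant to be 1 or -1, and [k] is the slope leaving [t] in that
    direction. *)
Definition affine_at h t d k := exists2 r, 0 < r &
  forall x, 0 <= x <= r -> h (t + d * x) = h t + k * x.

(** Piecewise linearity with integral slopes, stated through germs: taking maxima and differences
    then needs no common subdivision. *)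
Definition locally_affine a b h :=
  (forall t, a <= t < b -> exists k : int, affine_at h t 1 k%:~R) /\
  (forall t, a < t <= b -> exists k : int, affine_at h t (-1) k%:~R).

Definition affine_on h a b (k : int) :=
  forall t, a <= t <= b -> h t = h a + k%:~R * (t - a).

Lemma affine_on_right h a b (k : int) t :
  affine_on h a b k -> a <= t < b -> affine_at h t 1 k%:~R.
Proof.
move=> hab tab; exists (b - t) => [|x xr]; first lra.
by rewrite hab ?(hab t); [ring|lra|lra].
Qed.

Lemma affine_on_left h a b (k : int) t :
  affine_on h a b k -> a < t <= b -> affine_at h t (-1) (- k)%:~R.
Proof.
move=> hab tab; exists (t - a) => [|x xr]; first lra.
by rewrite hab ?(hab t) ?intrN; [ring|lra|lra].
Qed.

Lemma affine_at_sub h1 h2 t d k1 k2 c :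
  affine_at h1 t d k1 -> affine_at h2 t d k2 ->
  affine_at (fun x => h1 x - h2 x - c) t d (k1 - k2).
Proof.
move=> [r1 r10 h1E] [r2 r20 h2E]; exists (Num.min r1 r2).
  by rewrite lt_min r10.
by move=> x; rewrite le_min => /and3P[x0 xr1 xr2]; rewrite h1E ?h2E ?x0 //; ring.
Qed.

Lemma affine_at_add h t d k c :
  affine_at h t d k -> affine_at (fun x => h x + c) t d k.
Proof. by move=> [r r0 hE]; exists r => // x xr; rewrite hE //; ring. Qed.

Lemma affine_at_max_eq h1 h2 t d k1 k2 : h1 t = h2 t ->
  affine_at h1 t d k1 -> affine_at h2 t d k2 ->
  affine_at (fun x => Num.max (h1 x) (h2 x)) t d (Num.max k1 k2).
Proof.
move=> h12 [r1 r10 h1E] [r2 r20 h2E]; exists (Num.min r1 r2).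
  by rewrite lt_min r10.
move=> x; rewrite le_min => /and3P[x0 xr1 xr2].
rewrite h1E ?h2E ?x0 // h12 maxxx; have [k12|k12] := leP k1 k2.
  by apply: max_r; rewrite lerD2l ler_wpM2r.
by apply: max_l; rewrite lerD2l ler_wpM2r // ltW.
Qed.

Lemma affine_at_max_gt h1 h2 t d k1 k2 : h2 t < h1 t ->
  affine_at h1 t d k1 -> affine_at h2 t d k2 ->
  affine_at (fun x => Num.max (h1 x) (h2 x)) t d k1.
Proof.
move=> h12 [r1 r10 h1E] [r2 r20 h2E].
(* The constant [c] is positive and exceeds the difference of the slopes, so [h2] cannot make up the
   gap within the distance [r3]. *)
pose c := `|k1| + `|k2| + 1; pose r3 := (h1 t - h2 t) / c.
have c0 : 0 < c by rewrite ltr_wpDl // addr_ge0.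
have r30 : 0 < r3 by rewrite divr_gt0 // subr_gt0.
exists (Num.min (Num.min r1 r2) r3); first by rewrite !lt_min r10 r20.
move=> x; rewrite !le_min => /andP[x0 /andP[/andP[xr1 xr2] xr3]].
rewrite h1E ?h2E ?x0 // (max_l (ltW h12)); apply: max_l.
have : c * x <= h1 t - h2 t by rewrite mulrC -ler_pdivlMr.
have k1x : - `|k1| * x <= k1 * x by rewrite ler_wpM2r // lerNnormlW.
have k2x : k2 * x <= `|k2| * x by rewrite ler_wpM2r // ler_norm.
rewrite /c; nra.
Qed.

Lemma affine_at_opp h t d k :
  affine_at h t d k -> affine_at (fun x => h (- x)) (- t) (- d) k.
Proof.
move=> [r r0 hE]; exists r => // x xr; rewrite opprK -hE //.
by congr h; ring.
Qed.

Lemma locally_affine_opp a b h :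
  locally_affine a b h -> locally_affine (- b) (- a) (fun x => h (- x)).
Proof.
move=> [hr hl]; split=> t tab.
- have [|k /affine_at_opp hk] := hl (- t); first lra.
  by exists k; move: hk; rewrite !opprK.
- have [|k /affine_at_opp hk] := hr (- t); first lra.
  by exists k; move: hk; rewrite !opprK.
Qed.

Lemma locally_affine_sub_itv a b a' b' h : a <= a' -> b' <= b ->
  locally_affine a b h -> locally_affine a' b' h.
Proof. by move=> aa bb [hr hl]; split=> t tab; [apply: hr|apply: hl]; lra. Qed.

Lemma locally_affine_sub a b h1 h2 c :
  locally_affine a b h1 -> locally_affine a b h2 ->
  locally_affine a b (fun x => h1 x - h2 x - c).
Proof.
move=> [hr1 hl1] [hr2 hl2]; split=> t tab.
- have [k1 A1] := hr1 t tab; have [k2 A2] := hr2 t tab.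
  by exists (k1 - k2); rewrite intrB; exact: affine_at_sub.
- have [k1 A1] := hl1 t tab; have [k2 A2] := hl2 t tab.
  by exists (k1 - k2); rewrite intrB; exact: affine_at_sub.
Qed.

(** Continuous induction: the supremum of the points where [P] holds is reached through its left
    germ, and its right germ leads beyond it unless it is [b]. *)
Lemma locally_affine_ind a b h (P : R -> Prop) : a <= b ->
  locally_affine a b h -> P a ->
  (forall u u' (k : int), a <= u -> u < u' -> u' <= b -> affine_on h u u' k ->
     P u -> P u') -> P b.
Proof.
move=> ab [hr hl] Pa step.
pose S : set R := [set t | a <= t <= b /\ P t]%classic.
have Sa : S a by split=> //; rewrite lexx.
have supS : has_sup S.
  by split; [exists a|exists b => t [/andP[]]].
pose c := sup S.
have cb : c <= b by apply: ge_sup => [|t [/andP[]]]; first by exists a.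
have ac : a <= c by apply: ub_le_sup => //; case: supS.
have Pc : P c.
  have [ca|ca] := eqVneq c a; first by rewrite ca.
  have {ca ac} ac : a < c by rewrite lt_neqAle eq_sym ca.
  have [|k [r r0 hE]] := hl c; first by rewrite ac.
  have [t [tab Pt] ct] := sup_adherent r0 supS; rewrite -/c in ct.
  have tc : t <= c by apply: ub_le_sup; [case: supS|].
  have [<-//|tc'] := eqVneq t c.
  have {tc' tc} tc : t < c by rewrite lt_neqAle tc'.
  apply: (step t c (- k)) => //; first by case/andP: tab.
  move=> x /andP[tx xc].
  have -> : x = c + -1 * (c - x) by ring.
  have -> : h t = h (c + -1 * (c - t)) by congr h; ring.
  by rewrite !hE; [rewrite intrN; ring|lra|lra].
have [<-//|cb'] := eqVneq c b.
have {cb' cb} cb : c < b by rewrite lt_neqAle cb'.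
have [|k [r r0 hE]] := hr c; first by rewrite ac.
pose u := Num.min (c + r) b.
have cu : c < u by rewrite lt_min cb andbT; lra.
have ub : u <= b by rewrite ge_min lexx orbT.
have ur : u <= c + r by rewrite ge_min lexx.
have Su : S u.
  split; first lra.
  apply: (step c u k) => // x xcu.
  have -> : x = c + 1 * (x - c) by ring.
  by rewrite hE; [ring|lra].
have : u <= c by apply: ub_le_sup; [case: supS|].
by rewrite leNgt cu.
Qed.

(** On the first affine piece at whose end [h] is no longer positive, the slope is negative and the
    zero of [h] is the required point. A mere zero would not do: the nonzero slope is what later
    produces a chip. *)
Lemma crossing_right a b h : a <= b -> locally_affine a b h ->
  0 < h a -> h b <= 0 ->
  exists2 t, a < t <= b & h t = 0 /\ exists2 k, k != 0 & affine_at h t (-1) k.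
Proof.
move=> ab hL ha hb.
pose Q u := exists2 t, a < t <= u & h t = 0 /\ exists2 k, k != 0 & affine_at h t (-1) k.
suff [|//] : 0 < h b \/ Q b by rewrite ltNge hb.
apply: (@locally_affine_ind a b h (fun u => 0 < h u \/ Q u) ab hL); first by left.
move=> u u' k au uu' u'b hE [hu|[t tu ht]]; last by right; exists t => //; lra.
have [hu'|hu'] := ltP 0 (h u'); [by left|right].
have E : h u' = h u + k%:~R * (u' - u) by apply: hE; lra.
pose m : R := - k%:~R.
have m0 : 0 < m by rewrite /m; nra.
have tu : 0 < h u / m by rewrite divr_gt0.
have tu' : h u / m <= u' - u by rewrite ler_pdivrMr // /m; nra.
(* The zero of the affine piece, which descends from [h u] with slope [- m]. *)
exists (u + h u / m); first lra.
have ht : u < u + h u / m <= u' by lra.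
split.
  rewrite hE; last by case/andP: ht => /ltW -> ->.
  have -> : u + h u / m - u = h u / m by rewrite addrAC subrr add0r.
  by rewrite -[k%:~R]opprK mulNr mulrC divfK ?subrr // gt_eqF.
exists m; first by rewrite gt_eqF.
by have := affine_on_left hE ht; rewrite intrN.
Qed.

Lemma crossing_left a b h : a <= b -> locally_affine a b h ->
  0 < h b -> h a <= 0 ->
  exists2 t, a <= t < b & h t = 0 /\ exists2 k, k != 0 & affine_at h t 1 k.
Proof.
move=> ab hL hb ha; have nab : - b <= - a by rewrite lerN2.
have [||t tab [ht [k k0 A]]] := crossing_right nab (locally_affine_opp hL).
- by rewrite opprK.
- by rewrite opprK.
exists (- t); first lra.
split=> //; exists k => //; have := affine_at_opp A; rewrite opprK.
by case=> r r0 E; exists r => // x xr; have := E x xr; rewrite !opprK.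
Qed.

Lemma locally_affine_max a b h1 h2 :
  locally_affine a b h1 -> locally_affine a b h2 ->
  locally_affine a b (fun x => Num.max (h1 x) (h2 x)).
Proof.
move=> [hr1 hl1] [hr2 hl2].
have main t d : (exists k : int, affine_at h1 t d k%:~R) ->
    (exists k : int, affine_at h2 t d k%:~R) ->
    exists k : int, affine_at (fun x => Num.max (h1 x) (h2 x)) t d k%:~R.
  move=> [k1 A1] [k2 A2]; have [h12|h12|h12] := ltgtP (h1 t) (h2 t).
  - exists k2; have := affine_at_max_gt h12 A2 A1.
    by under [X in affine_at X]funext do rewrite maxC.
  - by exists k1; exact: (affine_at_max_gt h12 A1 A2).
  - have := affine_at_max_eq h12 A1 A2.
    by case: leP => _ A; [exists k2|exists k1].
by split=> t tab; apply: main; [exact: hr1|exact: hr2|exact: hl1|exact: hl2].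
Qed.

Lemma locally_affine_affine a b h (k : int) : affine_on h a b k ->
  locally_affine a b h.
Proof.
move=> hab; split=> t tab; first by exists k; exact: affine_on_right hab tab.
by exists (- k); exact: affine_on_left hab tab.
Qed.

Lemma locally_affine_eq a b h1 h2 : (forall t, a <= t <= b -> h1 t = h2 t) ->
  locally_affine a b h1 -> locally_affine a b h2.
Proof.
move=> h12 [hr hl]; split=> t tab.
- have [k [r r0 hE]] := hr t tab; exists k; exists (Num.min r (b - t)).
    by rewrite lt_min r0 subr_gt0; case/andP: tab.
  by move=> x; rewrite le_min => /and3P[x0 xr xb]; rewrite -!h12 ?hE ?x0 //; lra.
- have [k [r r0 hE]] := hl t tab; exists k; exists (Num.min r (t - a)).
    by rewrite lt_min r0 subr_gt0; case/andP: tab.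
  by move=> x; rewrite le_min => /and3P[x0 xr xb]; rewrite -!h12 ?hE ?x0 //; lra.
Qed.

Lemma affine_at_cvg_right h t k :
  affine_at h t 1 k -> (h x @[x --> t^'+] --> h t)%classic.
Proof.
move=> [r r0 hE].
have : ((h t + k * (x - t)) @[x --> t^'+] --> h t + k * (t - t))%classic.
  apply: cvg_at_right_filter; apply: cvgD; first exact: cvg_cst.
  by apply: cvgM; [exact: cvg_cst|apply: cvgB; [exact: cvg_id|exact: cvg_cst]].
rewrite subrr mulr0 addr0; apply: cvg_trans; apply: near_eq_cvg.
near=> x; have tx : t < x by near: x; exact: nbhs_right_gt.
have xr : x <= t + r by near: x; apply: nbhs_right_le; rewrite ltrDl.
by rewrite -hE; [congr h; ring|lra].
Unshelve. all: by end_near. Qed.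

Lemma affine_at_cvg_left h t k :
  affine_at h t (-1) k -> (h x @[x --> t^'-] --> h t)%classic.
Proof.
move=> [r r0 hE].
have : ((h t + k * (t - x)) @[x --> t^'-] --> h t + k * (t - t))%classic.
  apply: cvg_at_left_filter; apply: cvgD; first exact: cvg_cst.
  by apply: cvgM; [exact: cvg_cst|apply: cvgB; [exact: cvg_cst|exact: cvg_id]].
rewrite subrr mulr0 addr0; apply: cvg_trans; apply: near_eq_cvg.
near=> x; have tx : x < t by near: x; exact: nbhs_left_lt.
have xr : t - r <= x by near: x; apply: nbhs_left_ge; rewrite ltrBlDr ltrDl.
by rewrite -hE; [congr h; ring|lra].
Unshelve. all: by end_near. Qed.

Lemma locally_affine_continuous a b h : a < b -> locally_affine a b h ->
  ({within `[a, b], continuous h})%classic.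
Proof.
move=> ab [hr hl]; apply/(continuous_within_itvP h ab); split.
- move=> t; rewrite in_itv /= => /andP[at' tb].
  have [|k1 A1] := hr t; first by rewrite ltW.
  have [|k2 A2] := hl t; first by rewrite at' ltW.
  apply/left_right_continuousP; split.
    exact: affine_at_cvg_left A2.
  exact: affine_at_cvg_right A1.
- by have [|k A] := hr a; [rewrite lexx|exact: affine_at_cvg_right A].
- by have [|k A] := hl b; [rewrite ab lexx|exact: affine_at_cvg_left A].
Qed.

(** Turns the sum of the two outgoing slopes into a second difference at an arbitrarily small scale,
    whose sign can be read off from convexity. *)
Lemma affine_at_second_difference h t k1 k2 :
  affine_at h t 1 k1 -> affine_at h t (-1) k2 -> forall r, 0 < r ->
  exists2 x, 0 < x <= r & h (t + x) + h (t - x) - 2 * h t = (k1 + k2) * x.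
Proof.
move=> [r1 r10 h1] [r2 r20 h2] r r0; exists (Num.min r (Num.min r1 r2)).
  by rewrite !lt_min r0 r10 r20 ge_min lexx.
set x := Num.min _ _.
have x0 : 0 <= x by rewrite !le_min !ltW.
have -> : t + x = t + 1 * x by ring.
have -> : t - x = t + -1 * x by ring.
rewrite h1 ?h2 ?x0; first by ring.
  by rewrite !ge_min lexx ?orbT.
by rewrite !ge_min lexx ?orbT.
Qed.

End LocallyAffine.

(** * Piecewise linear functions on a metric graph *)

Section PiecewiseLinear.
Variable R : realType.
Implicit Types (h : R -> R) (a b c : R).

Lemma pl_integral_cons h a x b (k : int) : a < x -> affine_on h a x k ->
  pl_integral h x b -> pl_integral h a b.
Proof.
move=> ax hE [s [[xs sb] hs]]; exists (x :: s); split.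
  by split => //=; rewrite ax.
by case=> [_|i /= si]; [exists k|exact: hs].
Qed.

Lemma locally_affine_pl_integral h a b :
  a <= b -> locally_affine a b h -> pl_integral h a b.
Proof.
move=> ab hL.
(* Partitions grow at their front while the induction moves to the right, so the property carried
   along says that any partition starting at the current point extends back to [a]. *)
suff H : forall c, pl_integral h b c -> pl_integral h a c.
  apply: H; exists [::]; split => //; split=> //=.
apply: (@locally_affine_ind _ a b h
  (fun u => forall c, pl_integral h u c -> pl_integral h a c) ab hL) => //.
move=> u u' k _ uu' _ hE IH c hc; apply: IH; exact: (pl_integral_cons uu' hE).
Qed.

Lemma pl_integral_locally_affine h a b :
  pl_integral h a b -> locally_affine a b h.
Proof.
case=> s [[]]; elim: s a => [|x s IH] a /=.
  by move=> _ /eqP-> _; split=> t; lra.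
move=> /andP[ax xs] sb hs.
have [k hE] := hs 0%N isT.
have [hr hl] := IH x xs sb (fun i si => hs i.+1 si).
split=> t tab.
- have [tx|xt] := ltP t x; last by apply: hr; rewrite xt; case/andP: tab.
  by exists k; apply: (affine_on_right hE); case/andP: tab => -> _.
- have [tx|xt] := leP t x; last by apply: hl; rewrite xt; case/andP: tab.
  by exists (- k); apply: (affine_on_left hE); case/andP: tab => -> _.
Qed.

End PiecewiseLinear.

(** * Outgoing slopes of locally linear functions and of their maxima *)

Section MetricGraph.
Context (R : realType) (G : multigraph) (l : edge G -> R).
Hypothesis l_gt0 : forall e, 0 < l e.
Local Notation point := (mgpoint l).
Implicit Types (F g : point -> R) (p : point) (e : edge G) (v : vertex G).

Lemma seg0 e : seg l e 0 = inl (esrc e).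
Proof. by rewrite /seg insubN ?lexx //= ltxx. Qed.

Lemma seg_end e : seg l e (l e) = inl (etgt e).
Proof. by rewrite /seg insubN ?leNgt ?l_gt0 //= ltxx. Qed.

Lemma seg_interior e t (te : 0 < t < l e) :
  seg l e t = inr (exist (fun x : edge G * R => 0 < x.2 < l x.1) (e, t) te).
Proof.
rewrite /seg; case: insubP => [u /= _ ue|/=]; last by rewrite te.
by congr inr; apply: val_inj.
Qed.

Lemma seg_cover p : (exists v, p = inl v) \/
  (exists e t, 0 < t < l e /\ p = seg l e t).
Proof.
case: p => [v|[[e t] te]]; first by left; exists v.
by right; exists e, t; split; [|rewrite (seg_interior te)].
Qed.

Definition locally_linear F := forall e, locally_affine 0 (l e) (fun t => F (seg l e t)).

Lemma pl_function_locally_linear F : pl_function F -> locally_linear F.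
Proof. by move=> h e; have [_ /pl_integral_locally_affine] := h e. Qed.

Lemma slopeE F e t d k :
  affine_at (fun t => F (seg l e t)) t d k -> slope F e t d = k.
Proof.
move=> [r r0 hE]; apply/cvg_lim => //.
apply: cvg_near_cst.
near=> x; rewrite hE.
  have x0 : 0 < x by near: x; exact: nbhs_right_gt.
  by rewrite addrAC subrr add0r mulfK // gt_eqF.
by apply/andP; split; near: x; [exact: nbhs_right_ge|exact: nbhs_right_le].
Unshelve. all: by end_near. Qed.

(** The directions at [p]: an edge, an abscissa and a sense of travel. *)
Definition dirs p : seq (edge G * R * R) :=
  match p with
  | inl v => [seq (e, 0, 1) | e <- enum [pred e | esrc e == v]]
             ++ [seq (e, l e, -1) | e <- enum [pred e | etgt e == v]]
  | inr x => [:: ((val x).1, (val x).2, 1); ((val x).1, (val x).2, -1)]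
  end.

Definition dir_slope F (x : edge G * R * R) := slope F x.1.1 x.1.2 x.2.

Lemma sum_outgoing_slopesE F p :
  sum_outgoing_slopes F p = \sum_(x <- dirs p) dir_slope F x.
Proof.
case: p => [v|x] /=; last by rewrite big_cons big_seq1.
by rewrite big_cat !big_map !big_enum.
Qed.

Definition outgoing e (t d : R) := (0 <= t < l e /\ d = 1) \/ (0 < t <= l e /\ d = -1).

Lemma dirsP p x : x \in dirs p -> seg l x.1.1 x.1.2 = p /\ outgoing x.1.1 x.1.2 x.2.
Proof.
case: p => [v|[[e t] te]] /=.
  rewrite mem_cat => /orP[] /mapP[e]; rewrite mem_enum inE => /eqP <- -> /=.
    by rewrite seg0; split=> //; left; rewrite lexx l_gt0.
  by rewrite seg_end; split=> //; right; rewrite lexx l_gt0.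
have /= te' := te.
rewrite !inE => /orP[]/eqP-> /=; rewrite (seg_interior te); split=> //.
  by left; split=> //; lra.
by right; split=> //; lra.
Qed.

Lemma mem_dirs e t d : outgoing e t d -> (e, t, d) \in dirs (seg l e t).
Proof.
case=> -[te ->].
  have [->|t0] := eqVneq t 0.
    by rewrite seg0 /= mem_cat map_f // mem_enum inE.
  have te' : 0 < t < l e by rewrite lt_neqAle eq_sym t0.
  by rewrite (seg_interior te') /= !inE eqxx.
have [->|t0] := eqVneq t (l e).
  by rewrite seg_end /= mem_cat orbC map_f // mem_enum inE.
have te' : 0 < t < l e by case/andP: te => -> tl; rewrite lt_neqAle t0.
by rewrite (seg_interior te') /= !inE eqxx orbT.
Qed.

Lemma locally_linear_dir F e t d : locally_linear F -> outgoing e t d ->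
  exists2 k : int, slope F e t d = k%:~R & affine_at (fun t => F (seg l e t)) t d k%:~R.
Proof.
move=> /(_ e)[hr hl] [] [te ->].
  by have [k hk] := hr t te; exists k => //; exact: slopeE.
by have [k hk] := hl t te; exists k => //; exact: slopeE.
Qed.

Definition fmax F1 F2 p := Num.max (F1 p) (F2 p).

Lemma fmaxC F1 F2 : fmax F1 F2 = fmax F2 F1.
Proof. by apply: funext => p; rewrite /fmax maxC. Qed.

Lemma dir_slope_max_gt F1 F2 p x : locally_linear F1 -> locally_linear F2 ->
  F2 p < F1 p -> x \in dirs p -> dir_slope (fmax F1 F2) x = dir_slope F1 x.
Proof.
move=> L1 L2 F12 /dirsP[xp ox].
have [k1 s1 A1] := locally_linear_dir L1 ox.
have [k2 s2 A2] := locally_linear_dir L2 ox.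
rewrite {2}/dir_slope s1; apply: slopeE; apply: (affine_at_max_gt _ A1 A2).
by rewrite xp.
Qed.

Lemma dir_slope_max_eq F1 F2 p x : locally_linear F1 -> locally_linear F2 ->
  F1 p = F2 p -> x \in dirs p ->
  dir_slope (fmax F1 F2) x = Num.max (dir_slope F1 x) (dir_slope F2 x).
Proof.
move=> L1 L2 F12 /dirsP[xp ox].
have [k1 s1 A1] := locally_linear_dir L1 ox.
have [k2 s2 A2] := locally_linear_dir L2 ox.
rewrite {2}/dir_slope s1 {2}/dir_slope s2; apply: slopeE.
by apply: (affine_at_max_eq _ A1 A2); rewrite xp.
Qed.

Lemma locally_linear_max F1 F2 :
  locally_linear F1 -> locally_linear F2 -> locally_linear (fmax F1 F2).
Proof. by move=> L1 L2 e; exact: locally_affine_max. Qed.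

Lemma locally_linear_shift F (s : R) :
  locally_linear F -> locally_linear (fun p => F p + s).
Proof.
move=> L e; have [hr hl] := L e; split=> t te.
  by have [k A] := hr t te; exists k; exact: affine_at_add.
by have [k A] := hl t te; exists k; exact: affine_at_add.
Qed.

Lemma slopes_shift F (s : R) p : locally_linear F ->
  sum_outgoing_slopes (fun p => F p + s) p = sum_outgoing_slopes F p.
Proof.
move=> L; rewrite !sum_outgoing_slopesE !big_seq; apply: eq_bigr => x /dirsP[_ ox].
have [k s1 A1] := locally_linear_dir L ox.
by rewrite {2}/dir_slope s1; apply: slopeE; exact: affine_at_add.
Qed.

Lemma slopes_max_gt F1 F2 p : locally_linear F1 -> locally_linear F2 ->
  F2 p < F1 p -> sum_outgoing_slopes (fmax F1 F2) p = sum_outgoing_slopes F1 p.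
Proof.
move=> L1 L2 F12; rewrite !sum_outgoing_slopesE !big_seq.
by apply: eq_bigr => x xp; exact: dir_slope_max_gt xp.
Qed.

(** Where the functions agree, each outgoing slope of the maximum is the larger of the two;
    elsewhere the maximum is locally [F1]. This is why maxima preserve effectiveness. *)
Lemma slopes_max_ge F1 F2 p : locally_linear F1 -> locally_linear F2 ->
  F2 p <= F1 p -> sum_outgoing_slopes F1 p <= sum_outgoing_slopes (fmax F1 F2) p.
Proof.
move=> L1 L2; rewrite le_eqVlt => /orP[/eqP F12|F12]; last by rewrite slopes_max_gt.
rewrite !sum_outgoing_slopesE !big_seq; apply: ler_sum => x xp.
by rewrite (dir_slope_max_eq L1 L2 (esym F12) xp) le_max lexx.
Qed.

Lemma slopes_max_strict F1 F2 p x : locally_linear F1 -> locally_linear F2 ->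
  F1 p = F2 p -> x \in dirs p -> dir_slope F1 x < dir_slope F2 x ->
  sum_outgoing_slopes F1 p < sum_outgoing_slopes (fmax F1 F2) p.
Proof.
move=> L1 L2 F12 xp ltx; rewrite !sum_outgoing_slopesE.
rewrite !(big_rem x xp) /=; apply: ltr_leD.
  by rewrite (dir_slope_max_eq L1 L2 F12 xp) lt_max ltx orbT.
rewrite !big_seq; apply: ler_sum => y /mem_rem yp.
by rewrite (dir_slope_max_eq L1 L2 F12 yp) le_max lexx.
Qed.

End MetricGraph.

(** * Principal divisors *)

Section PrincipalDivisor.
Context (R : realType) (G : multigraph) (l : edge G -> R).
Hypothesis l_gt0 : forall e, 0 < l e.
Local Notation point := (mgpoint l).
Implicit Types (F g : point -> R) (p : point) (e : edge G) (v : vertex G).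

(** Each affine piece of slope [k] contributes [k] at its left end and [- k] at its right end, so
    the total over the edge vanishes. The list [s] collects the interior ends of pieces. *)
Lemma edge_breakpoints F e : locally_linear F -> exists s : seq R,
  [/\ uniq s, forall t, t \in s -> 0 < t < l e,
      forall t, 0 < t < l e -> t \notin s -> slope F e t 1 + slope F e t (-1) = 0
    & slope F e 0 1 + slope F e (l e) (-1)
      + \sum_(t <- s) (slope F e t 1 + slope F e t (-1)) = 0].
Proof.
move=> /(_ e) hL.
pose P u := u = 0 \/ 0 < u /\ exists s : seq R,
  [/\ uniq s, forall t, t \in s -> 0 < t < u,
      forall t, 0 < t < u -> t \notin s -> slope F e t 1 + slope F e t (-1) = 0
    & slope F e 0 1 + slope F e u (-1)
      + \sum_(t <- s) (slope F e t 1 + slope F e t (-1)) = 0].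
suff [/eqP|[]//] : P (l e) by rewrite gt_eqF.
apply: (@locally_affine_ind _ 0 (l e) _ P (ltW (l_gt0 e)) hL); first by left.
move=> u u' k u0 uu' u'l hE.
have sr t : u <= t < u' -> slope F e t 1 = k%:~R.
  by move=> tu; apply: slopeE; exact: affine_on_right hE tu.
have sl t : u < t <= u' -> slope F e t (-1) = - k%:~R.
  by move=> tu; apply: slopeE; rewrite -intrN; exact: affine_on_left hE tu.
have s0 t : u < t < u' -> slope F e t 1 + slope F e t (-1) = 0.
  by move=> /andP[ut tu']; rewrite sr ?sl ?subrr ?ut ?tu' ?ltW.
case=> [uE|[u0' [s [us su sz ssum]]]]; right; (split; first exact: le_lt_trans uu').
  exists [::]; split => // [t tu _|]; first by apply: s0; rewrite uE.
  by rewrite big_nil addr0 sr ?sl ?subrr // uE ?lexx -uE ?uu' ?lexx.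
exists (u :: s).
have us' : u \notin s by apply/negP => /su; rewrite ltxx andbF.
split.
- by rewrite /= us'.
- move=> t; rewrite inE => /predU1P[->|/su]; first by rewrite u0'.
  by move=> /andP[-> /lt_trans]; apply.
- move=> t /andP[t0 tu']; rewrite inE negb_or => /andP[tu ts].
  have [tltu|tgtu|tu0] := ltgtP t u; last by rewrite tu0 eqxx in tu.
    by apply: sz; rewrite ?t0.
  by apply: s0; rewrite tgtu.
- rewrite big_cons (sr u) ?lexx ?uu' // (sl u') ?lexx ?uu' //.
  by rewrite -[RHS]ssum; ring.
Qed.

Lemma seg_interior_inj e e' t t' : 0 < t < l e -> 0 < t' < l e' ->
  seg l e t = seg l e' t' -> e = e' /\ t = t'.
Proof. by move=> te te'; rewrite (seg_interior te) (seg_interior te') => -[]. Qed.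

(** The divisor is assembled edge by edge from the breakpoints, each edge contributing degree 0. *)
Lemma principal_divisor F : locally_linear F ->
  exists2 E : {freeg point}, is_div F E & deg E = 0.
Proof.
move=> L.
have [s sP] := choice (fun e => edge_breakpoints e L).
(* Slopes are integers seen in [R]; the floor recovers them as coefficients. *)
pose a e (t d : R) : int := Num.floor (slope F e t d).
have aE e t d : outgoing l e t d -> (a e t d)%:~R = slope F e t d.
  by move=> /(locally_linear_dir L)[k sk _]; rewrite /a sk intrKfloor.
have aE0 e : (a e 0 1)%:~R = slope F e 0 1.
  by apply: aE; left; rewrite lexx l_gt0.
have aEl e : (a e (l e) (-1))%:~R = slope F e (l e) (-1).
  by apply: aE; right; rewrite lexx l_gt0.
have aEt e t : 0 < t < l e ->
    (a e t 1 + a e t (-1))%:~R = slope F e t 1 + slope F e t (-1).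
  move=> te; rewrite intrD !aE //; first by right; split=> //; lra.
  by left; split=> //; lra.
pose E e : {freeg point} := << a e 0 1 *g inl (esrc e) >>
  + << a e (l e) (-1) *g inl (etgt e) >>
  + \sum_(t <- s e) << a e t 1 + a e t (-1) *g seg l e t >>.
exists (\sum_e E e); last first.
  rewrite raddf_sum big1 // => e _; rewrite /E /= !degD !degU raddf_sum /=.
  have [_ se _ sum0] := sP e.
  apply: (@intr_inj R); rewrite !intrD rmorph_sum /= aE0 aEl -[RHS]sum0.
  congr (_ + _); rewrite !big_seq.
  by apply: eq_bigr => t ts; rewrite degU aEt // se.
move=> p; rewrite raddf_sum rmorph_sum /=.
case: (seg_cover p) => [[v ->]|[e [t [te ->]]]].
  rewrite /= !(big_mkcond (fun e => _ == v)) -big_split /=.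
  apply: eq_bigr => e _; rewrite /E /= !coeffD !coeffU raddf_sum /= big1_seq ?addr0.
    rewrite intrD !intrM aE0 aEl; congr (_ + _).
      by rewrite [inl _ == _](_ : _ = (esrc e == v)) //; case: eqP; rewrite ?mulr1 ?mulr0.
    by rewrite [inl _ == _](_ : _ = (etgt e == v)) //; case: eqP; rewrite ?mulr1 ?mulr0.
  move=> t /= ts; have [_ se _ _] := sP e.
  by rewrite coeffU (seg_interior (se _ ts)) mulr0.
have -> : sum_outgoing_slopes F (seg l e t) = slope F e t 1 + slope F e t (-1).
  by rewrite (seg_interior te).
rewrite (bigD1 e) //= [X in _ + X]big1 ?addr0.
  rewrite /E /= !coeffD !coeffU (seg_interior te) !mulr0 !add0r raddf_sum /=.
  have [us se sz _] := sP e.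
  rewrite (eq_big_seq (fun t' => if t' == t then a e t 1 + a e t (-1) else 0)).
    rewrite -big_mkcond big_const_seq.
    have -> : count (pred1 t) (s e) = (t \in s e).
      by rewrite count_uniq_mem.
    case: (boolP (t \in s e)) => ts /=; first by rewrite addr0 aEt.
    by rewrite sz.
  move=> t' ts' /=; rewrite coeffU -(seg_interior te).
  have [<-|tt'] := eqVneq t' t; first by rewrite eqxx mulr1.
  case: eqP => [/(seg_interior_inj (se _ ts') te)[_ /eqP]|_].
    by rewrite (negbTE tt').
  by rewrite mulr0.
move=> e' ne; rewrite /E /= !coeffD !coeffU (seg_interior te) !mulr0 !add0r raddf_sum /=.
have [_ se _ _] := sP e'.
rewrite big1_seq // => t' /= ts'; rewrite coeffU -(seg_interior te).
case: eqP => [/(seg_interior_inj (se _ ts') te)[/eqP]|_].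
  by rewrite (negbTE ne).
by rewrite mulr0.
Qed.

Lemma effective_size_dom (D : {freeg point}) :
  effective D -> (size (dom D))%:Z <= deg D.
Proof.
move=> De; rewrite -[in X in _ <= X](freeg_sumE D) raddf_sum /=.
have -> : (size (dom D))%:Z = \sum_(z <- dom D) 1.
  by rewrite big_const_seq count_predT iter_addr_0 natz.
rewrite big_seq [X in _ <= X]big_seq; apply: ler_sum => z; rewrite mem_dom degU.
by move=> zD; have := De z; rewrite le_eqVlt eq_sym (negbTE zD).
Qed.

End PrincipalDivisor.

(** * Functions turning [D] into an effective divisor, and their chips *)

Section Admissible.
Context (R : realType) (G : multigraph) (l : edge G -> R).
Hypothesis l_gt0 : forall e, 0 < l e.
Local Notation point := (mgpoint l).
Variable D : {freeg point}.
Implicit Types (F : point -> R) (p : point) (e : edge G).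

(** The coefficient at [p] of [D + div F]. *)
Definition value F p : R := (coeff p D)%:~R + sum_outgoing_slopes F p.
Definition admissible F := locally_linear F /\ forall p, 0 <= value F p.

(** Multiplicities and exact positions inside edges are forgotten, so several chips may be recorded
    as one. *)
Definition chips F : config G :=
  (finset (fun v => 0 < value F (inl v)),
   finset (fun e => `[< exists2 t, 0 < t < l e & 0 < value F (seg l e t) >])).

Lemma admissible_divisor F : admissible F -> exists E : {freeg point},
  [/\ effective E, deg E = deg D, is_div F (E - D)
    & forall p, (coeff p E)%:~R = value F p].
Proof.
move=> [L F0]; have [E divE degE] := principal_divisor l_gt0 L.
have ED p : (coeff p (D + E))%:~R = value F p by rewrite coeffD intrD divE.
exists (D + E); split=> //; last by rewrite addrAC subrr add0r.
  by move=> p; rewrite -(ler0z R) ED F0.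
by rewrite degD degE addr0.
Qed.

(** Every recorded vertex or edge is the image under [proj] of a point of the support, and an
    effective divisor has at most as many support points as its degree. *)
Lemma chips_card F : admissible F -> ((#|(chips F).1| + #|(chips F).2|)%N%:Z <= deg D)%R.
Proof.
move=> /admissible_divisor[E [E0 <- _ EF]]; apply: le_trans (effective_size_dom E0).
pose proj (p : point) : vertex G + edge G :=
  match p with inl v => inl v | inr x => inr (val x).1 end.
pose s := [seq inl v | v <- enum (chips F).1] ++ [seq inr e | e <- enum (chips F).2]
  : seq (vertex G + edge G).
have us : uniq s.
  rewrite cat_uniq !map_inj_uniq ?enum_uniq //=; try by move=> ? ? [].
  by rewrite andbT; apply/hasPn => _ /mapP[e _ ->]; apply/negP => /mapP[].
have : {subset s <= map proj (dom E)}.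
  have domF p : 0 < value F p -> p \in dom E.
    by rewrite mem_dom -(intr_eq0 R) EF => /gt_eqF ->.
  move=> x; rewrite mem_cat => /orP[] /mapP[y]; rewrite mem_enum inE.
    by move=> /domF yE ->; apply/mapP; exists (inl y).
  move=> /asboolP[t ty /domF yE] ->; apply/mapP; exists (seg l y t) => //.
  by rewrite (seg_interior ty).
move=> /(uniq_leq_size us); rewrite size_cat !size_map -!cardE.
by rewrite lez_nat.
Qed.

Lemma value_max_ge F1 F2 p : locally_linear F1 -> locally_linear F2 ->
  F2 p <= F1 p -> value F1 p <= value (fmax F1 F2) p.
Proof. by move=> L1 L2 F12; rewrite lerD2l slopes_max_ge. Qed.

Lemma admissible_max F1 F2 :
  admissible F1 -> admissible F2 -> admissible (fmax F1 F2).
Proof.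
move=> [L1 v1] [L2 v2]; split=> [|p]; first exact: locally_linear_max.
have [F12|F12] := leP (F2 p) (F1 p).
  exact: le_trans (v1 p) (value_max_ge L1 L2 F12).
by rewrite fmaxC; exact: le_trans (v2 p) (value_max_ge L2 L1 (ltW F12)).
Qed.

Lemma value_shift F (s : R) p :
  locally_linear F -> value (fun p => F p + s) p = value F p.
Proof. by move=> L; rewrite /value slopes_shift. Qed.

Lemma admissible_shift F (s : R) : admissible F -> admissible (fun p => F p + s).
Proof.
move=> [L v]; split=> [|p]; first exact: locally_linear_shift.
by rewrite value_shift.
Qed.

(** Passing to the maximum, the function with the smaller slope along [x] gains strictly there and
    loses in no direction, while its own value is already nonnegative. *)
Lemma value_max_gt0 F1 F2 p x : admissible F1 -> admissible F2 -> F1 p = F2 p ->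
  x \in dirs p -> dir_slope F1 x != dir_slope F2 x -> 0 < value (fmax F1 F2) p.
Proof.
move=> [L1 v1] [L2 v2] F12 xp; rewrite neq_lt => /orP[] lt12.
  apply: le_lt_trans (v1 p) _; rewrite ltrD2l.
  exact: (slopes_max_strict l_gt0 L1 L2 F12 xp).
apply: le_lt_trans (v2 p) _; rewrite ltrD2l fmaxC.
exact: (slopes_max_strict l_gt0 L2 L1 (esym F12) xp).
Qed.

(** The difference [h] has a zero with a nonzero outgoing slope; there the two functions meet with
    different slopes, so their maximum has a chip. *)
Lemma edge_crossing F1 F2 e (a b : R) : admissible F1 -> admissible F2 ->
  0 <= a <= l e -> 0 <= b <= l e ->
  F2 (seg l e a) < F1 (seg l e a) -> F1 (seg l e b) <= F2 (seg l e b) ->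
  exists t, [/\ (a < t <= b) || (b <= t < a), F1 (seg l e t) = F2 (seg l e t)
              & 0 < value (fmax F1 F2) (seg l e t)].
Proof.
move=> A1 A2 ae be Fa Fb.
have L1 := A1.1; have L2 := A2.1.
pose h t := F1 (seg l e t) - F2 (seg l e t) - 0.
have hL : locally_affine 0 (l e) h by apply: locally_affine_sub; [exact: L1|exact: L2].
have chip t d k : outgoing l e t d -> h t = 0 -> k != 0 -> affine_at h t d k ->
    F1 (seg l e t) = F2 (seg l e t) /\ 0 < value (fmax F1 F2) (seg l e t).
  move=> o ht k0 hA.
  have F12 : F1 (seg l e t) = F2 (seg l e t) by move: ht; rewrite /h; lra.
  split=> //; apply: (value_max_gt0 A1 A2 F12 (mem_dirs l_gt0 o)).
  have [k1 s1 B1] := locally_linear_dir L1 o.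
  have [k2 s2 B2] := locally_linear_dir L2 o.
  rewrite /dir_slope /= s1 s2 -subr_eq0.
  (* Compared on a common radius, the two descriptions of the germ of [h] give [k = k1 - k2]. *)
  have [r1 r10 E1] := hA; have [r2 r20 E2] := affine_at_sub 0 B1 B2.
  pose r := Num.min r1 r2; have r0 : 0 < r by rewrite lt_min r10.
  have := E1 r; rewrite ge_min lexx ltW // => /(_ isT).
  have := E2 r; rewrite ge_min lexx orbT ltW // => /(_ isT).
  rewrite -/(h _) => -> /addrI /(mulIf (lt0r_neq0 r0)) ->.
  by [].
have ha : 0 < h a by rewrite /h; lra.
have hb : h b <= 0 by rewrite /h; lra.
have [ab|ab|ab] := ltgtP a b.
- have [||||t tab [ht [k k0 hA]]] := @crossing_right _ a b h; first exact: ltW.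
  + by apply: locally_affine_sub_itv hL; lra.
  + by [].
  + by [].
  have [|FE c] := chip t (-1) k _ ht k0 hA; first by right; split=> //; lra.
  by exists t; rewrite tab.
- have [||||t tab [ht [k k0 hA]]] := @crossing_left _ b a h; first exact: ltW.
  + by apply: locally_affine_sub_itv hL; lra.
  + by [].
  + by [].
  have [|FE c] := chip t 1 k _ ht k0 hA; first by left; split=> //; lra.
  by exists t; rewrite tab orbT.
- by move: hb; rewrite -ab leNgt ha.
Qed.

End Admissible.

(** * The sweep *)

Lemma exists_slightly_larger (R : realType) (xs : seq R) (s : R) :
  exists2 s', s < s' & {in xs, forall x, s < x -> s' < x}.
Proof.
elim: xs => [|x xs [s' ss' IH]]; first by exists (s + 1) => //; rewrite ltrDl.
have [sx|xs'] := ltP s x; last first.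
  exists s' => // y; rewrite inE => /predU1P[->|/IH //].
  by rewrite ltNge xs'.
exists (Num.min s' ((s + x) / 2)); first by rewrite lt_min ss' /=; lra.
move=> y; rewrite inE => /predU1P[-> _|/IH h /h].
  by rewrite gt_min orbC; apply/orP; left; lra.
by rewrite gt_min => ->.
Qed.

Section Sweep.
Context (R : realType) (G : multigraph) (l : edge G -> R).
Hypothesis l_gt0 : forall e, 0 < l e.
Local Notation point := (mgpoint l).
Variable D : {freeg point}.
Implicit Types (F g : point -> R) (p : point) (e : edge G) (v : vertex G).
Implicit Types (C : {set vertex G}) (phi : edge G -> vertex G).

Lemma covers_admissible p : covers D p ->
  exists2 F, admissible D F & 0 < value D F p.
Proof.
move=> [D' [D'0 [F /pl_function_locally_linear L dF] pD']].
have FD' q : value D F q = (coeff q D')%:~R.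
  by rewrite /value -dF -intrD coeffB addrC subrK.
exists F; first by split=> // q; rewrite FD' ler0z.
by rewrite FD' ltr0z lt_neqAle eq_sym -mem_dom pD' D'0.
Qed.

Definition abscissa e v : R := if esrc e == v then 0 else l e.

Lemma seg_abscissa e v : v \in [set esrc e; etgt e] -> seg l e (abscissa e v) = inl v.
Proof.
rewrite /abscissa !inE eq_sym; case: eqP => [<- _|_]; first exact: seg0.
by move=> /= /eqP ->; exact: seg_end.
Qed.

Lemma abscissa_itv e v : 0 <= abscissa e v <= l e.
Proof. by rewrite /abscissa; case: ifP; rewrite lexx ltW. Qed.

(** Locates a crossing found while travelling from [a] to the end [v]: since [t] differs from [a],
    it cannot be the opposite end. *)
Lemma abscissa_between e (a t : R) v : v \in [set esrc e; etgt e] ->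
  0 <= a <= l e -> (a < t <= abscissa e v) || (abscissa e v <= t < a) ->
  t = abscissa e v \/ 0 < t < l e.
Proof.
move=> ve; rewrite /abscissa; case: ifP => _ ae.
  by case/orP => tb; have [->|t0] := eqVneq t 0; [left| lra |left|right; lra].
by case/orP => tb; have [->|t0] := eqVneq t (l e); [left|right; lra|left| lra].
Qed.

(** With no chip on [C], a chip at the label of [e] sits at the outer end. So the guarding chip is
    never at the inner end and has room to move inwards. *)
Lemma guard_position g C phi e : labelling phi -> e \in edge_cut C ->
  (chips D g).1 :&: C = finset.set0 ->
  (phi e \in (chips D g).1) || (e \in (chips D g).2) ->
  exists t, [/\ 0 <= t <= l e, t != abscissa e (inner C e),
    0 < value D g (seg l e t) & 0 < t < l e \/ seg l e t = inl (phi e)].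
Proof.
move=> lphi eC dis /orP[phic|].
  have phiC : phi e \notin C.
    apply/negP => phiC; have /setP/(_ (phi e)) := dis.
    by rewrite !inE in phic *; rewrite phic phiC.
  exists (abscissa e (phi e)); rewrite abscissa_itv seg_abscissa //.
  split=> //; last by right.
    rewrite /abscissa /inner; move: eC phiC (lphi e) (loopless e); rewrite !inE.
    case: (boolP (esrc e \in C)) => sC /= tC pC /orP[]/eqP pe ne; rewrite pe in pC *.
    - by rewrite sC in pC.
    - by rewrite (negbTE ne) eqxx gt_eqF.
    - by rewrite (negbTE ne) eqxx lt_eqF.
    - by rewrite tC in pC.
  by move: phic; rewrite inE.
rewrite inE => /asboolP[t te vt]; exists t; split=> //; last by left.
  by case/andP: te => /ltW -> /ltW ->.
by rewrite /abscissa; case: ifP => _; [rewrite gt_eqF|rewrite lt_eqF]; case/andP: te.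
Qed.


(** Here [g'] puts a chip on the vertex [v] of [C], and [s] is the maximum of [g' - g] on [C]. The
    configuration [c1] is read at a level [s'] slightly above [s], and [c2] at [s] itself. *)
Lemma chips_move c C phi : (forall v, covers D (inl v)) ->
  (exists2 g, admissible D g & c = chips D g) -> C != finset.set0 ->
  c.1 :&: C = finset.set0 -> labelling phi -> guards c (edge_cut C) phi ->
  let state c := exists2 g, admissible D g & c = chips D g in
  exists c1 c2 psi,
    [/\ state c1, state c2, labelling psi
      & {in edge_cut C, forall e, psi e = phi e \/ psi e = inner C e}] /\
    [/\ guards c1 (edge_cut C) phi, guards c1 (edge_cut C) psi, guards c2 (edge_cut C) psi
      & c2.1 :&: C = finset.set0 -> exists W : {set vertex G},
          [/\ W \proper C, W != finset.set0
            & edge_cut W :&: edge_cut (C :\: W) \subset c2.2]].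
Proof.
move=> cov [g gA ->] /set0Pn[v vC] dis lphi gphi /=.
have [g' g'A vg'] := covers_admissible (cov v).
pose f p := g' p - g p.
pose w := [arg max_(u > v in C) f (inl u)]%O.
have [wC wmax] : w \in C /\ forall u, u \in C -> f (inl u) <= f (inl w).
  by rewrite /w; case: arg_maxP.
pose s := f (inl w).
pose lev r := fmax g' (fun p => g p + r).
have levA r : admissible D (lev r).
  by apply: admissible_max => //; exact: admissible_shift.
have shA r := admissible_shift (D := D) l_gt0 r gA.
(* Where [f] is at most [r], the maximum is attained by [g + r] and the chips of [g] survive; where
   [f] is at least [r], it is attained by [g'], whose chips appear. *)
have keep r p : f p <= r -> 0 < value D g p -> 0 < value D (lev r) p.
  move=> fp; rewrite -(value_shift l_gt0 D r p gA.1) /lev fmaxC => vp.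
  apply: lt_le_trans vp _; apply: value_max_ge => //; first exact: (shA r).1.
    exact: g'A.1.
  by rewrite /f in fp; lra.
have reach r p : r <= f p -> 0 < value D g' p -> 0 < value D (lev r) p.
  move=> fp vp; apply: lt_le_trans vp _; apply: value_max_ge => //.
  - exact: g'A.1.
  - exact: (shA r).1.
  - by rewrite /f in fp; lra.
have cross r e (a b : R) : 0 <= a <= l e -> 0 <= b <= l e ->
    r < f (seg l e a) -> f (seg l e b) <= r ->
    exists t, [/\ (a < t <= b) || (b <= t < a), f (seg l e t) = r
                & 0 < value D (lev r) (seg l e t)].
  move=> ae be fa fb.
  have [||t [tab ft vt]] := edge_crossing l_gt0 g'A (shA r) ae be.
  - by rewrite /f in fa; lra.
  - by rewrite /f in fb; lra.
  by exists t; split=> //; rewrite /f ft; lra.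
have cross' r e (a b : R) : 0 <= a <= l e -> 0 <= b <= l e ->
    f (seg l e a) < r -> r <= f (seg l e b) ->
    exists t, [/\ (a < t <= b) || (b <= t < a)
                & 0 < value D (lev r) (seg l e t)].
  move=> ae be fa fb.
  have [||t [tab ft vt]] := edge_crossing l_gt0 (shA r) g'A ae be.
  - by rewrite /f in fa; lra.
  - by rewrite /f in fb; lra.
  by exists t; split=> //; rewrite /lev fmaxC.
have [pos posP] : {pos : edge G -> R & forall e, e \in edge_cut C ->
    [/\ 0 <= pos e <= l e, pos e != abscissa e (inner C e),
        0 < value D g (seg l e (pos e))
      & 0 < pos e < l e \/ seg l e (pos e) = inl (phi e)]}.
  apply: (@choice _ _ (fun e t => e \in edge_cut C ->
    [/\ 0 <= t <= l e, t != abscissa e (inner C e), 0 < value D g (seg l e t)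
      & 0 < t < l e \/ seg l e t = inl (phi e)])) => e.
  have [eC|] := boolP (e \in edge_cut C); last by exists 0.
  by have [t tP] := guard_position lphi eC dis (gphi e eC); exists t.
(* Just above the level [s], all chips that move are still in the interior of
   their edges, which may then be relabelled freely. *)
have [s' ss' s'P] :=
  exists_slightly_larger [seq f (seg l e (pos e)) | e <- enum (edge_cut C)] s.
have {}s'P e : e \in edge_cut C -> s < f (seg l e (pos e)) -> s' < f (seg l e (pos e)).
  by move=> eC; apply: s'P; apply/map_f; rewrite mem_enum.
have inter h e t : 0 < t < l e -> 0 < value D h (seg l e t) -> e \in (chips D h).2.
  by move=> te vt; rewrite inE; apply/asboolP; exists t.
have innerE e : e \in edge_cut C -> seg l e (abscissa e (inner C e)) = inl (inner C e).
  by move=> eC; apply: seg_abscissa; exact: inner_end.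
have finner e : e \in edge_cut C -> f (inl (inner C e)) <= s.
  by move=> eC; apply: wmax; exact: inner_in.
(* The guarding chip of such an edge has not yet been moved at level [r]. *)
have stay r e : e \in edge_cut C -> f (seg l e (pos e)) <= r ->
    (phi e \in (chips D (lev r)).1) || (e \in (chips D (lev r)).2).
  move=> eC fe; have [_ _ vp pe] := posP e eC.
  have := keep r _ fe vp; case: pe => [pe|->] vp'.
    by rewrite (inter _ _ _ pe vp') orbT.
  by rewrite inE vp'.
(* Between the old chip, where [f] exceeds [r], and the inner end, where it does not, [f] crosses
   [r] at a new chip. This chip is interior unless [f] equals [r] at the inner end. *)
have move r e : e \in edge_cut C -> s <= r -> r < f (seg l e (pos e)) ->
    (inner C e \in (chips D (lev r)).1) && (f (inl (inner C e)) == r)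
    || (e \in (chips D (lev r)).2).
  move=> eC sr fe; have [pe pI vp _] := posP e eC.
  have [|t [tb ft vt]] :=
    cross r e (pos e) (abscissa e (inner C e)) pe (abscissa_itv _ _) fe.
    by rewrite innerE //; exact: le_trans (finner e eC) sr.
  have [tE|te] := abscissa_between (inner_end C e) pe tb.
    by rewrite tE innerE // in ft vt; rewrite inE vt ft eqxx.
  by rewrite (inter _ _ _ te vt) orbT.
(* An edge takes its inner end as label when its chip has moved by level [s] and that end then holds
   a chip. *)
pose psi e :=
  if [&& e \in edge_cut C, s < f (seg l e (pos e))
       & inner C e \in (chips D (lev s)).1]
  then inner C e else phi e.
have free e lab : e \in edge_cut C -> s < f (seg l e (pos e)) ->
    (lab \in (chips D (lev s')).1) || (e \in (chips D (lev s')).2).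
  move=> eC fe; have := move s' e eC (ltW ss') (s'P e eC fe).
  rewrite lt_eqF ?andbF => [/= ->|]; first by rewrite orbT.
  exact: le_lt_trans (finner e eC) ss'.
exists (chips D (lev s')), (chips D (lev s)), psi; split; split.
- by exists (lev s').
- by exists (lev s).
- by move=> e; rewrite /psi; case: ifP => _ //; exact: inner_end.
- by move=> e eC; rewrite /psi; case: ifP => _; [right|left].
- move=> e eC; have [fe|fe] := leP (f (seg l e (pos e))) s.
    by apply: stay => //; exact: le_trans fe (ltW ss').
  exact: free.
- move=> e eC; have [fe|fe] := leP (f (seg l e (pos e))) s.
    rewrite /psi (leNgt _ s) in fe *; rewrite (negbTE fe) andbF.
    by apply: stay => //; rewrite -leNgt in fe; exact: le_trans fe (ltW ss').
  exact: free.
- move=> e eC; rewrite /psi eC; have [fe|fe] := leP (f (seg l e (pos e))) s => /=.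
    exact: stay.
  have := move s e eC (lexx _) fe; case: ifP => [-> //|_].
  by move=> /= ->; rewrite orbT.
move=> dis2.
have nochip u : u \in C -> ~ 0 < value D (lev s) (inl u).
  by move=> uC vu; have /setP/(_ u) := dis2; rewrite !inE vu uC.
exists (finset (fun u => (u \in C) && (f (inl u) == s))); split.
(* If [f] were maximal at [v], the chip of [g'] on [v] would be present at level [s], contradicting
   that [C] holds no chip. *)
- apply/properP; split; first by apply/fintype.subsetP => u; rewrite inE => /andP[].
  exists v => //; rewrite inE vC /=; apply/eqP => fv.
  by apply: (nochip v vC); apply: reach => //; rewrite fv.
- by apply/set0Pn; exists w; rewrite inE wC eqxx.
- apply/fintype.subsetP => e; rewrite inE => /andP[eW eCW].
  set W := finset _ in eW eCW *.
  have := inner_in eW; have := inner_in eCW.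
  set y := inner _ e; set x := inner W e; rewrite !inE => /andP[yW yC] /andP[xC /eqP fx].
  have fy : f (inl y) < s.
    by rewrite lt_neqAle wmax // andbT; move: yW; rewrite yC.
  have xe := inner_end W e; have ye := inner_end (C :\: W) e.
  (* From [y], where [f] is below [s], to [x], where it equals [s], there is a chip; it is not on
     [x], as [C] holds none, hence it is interior. *)
  have [||t [tb vt]] := cross' s e (abscissa e y) (abscissa e x)
    (abscissa_itv _ _) (abscissa_itv _ _).
  + by rewrite seg_abscissa.
  + by rewrite seg_abscissa // fx.
  have [tE|te] := abscissa_between xe (abscissa_itv _ _) tb; last by exists t.
  by rewrite tE seg_abscissa // in vt; case: (nochip x xC).
Qed.
End Sweep.

(** * Gonality *)

Section GonalityAttained.
Context (R : realType) (G : multigraph) (l : edge G -> R).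
Hypothesis l_gt0 : forall e, 0 < l e.
Local Notation point := (mgpoint l).
Implicit Types (F g : point -> R) (p : point) (e : edge G) (v : vertex G) (t : R).

Lemma locally_linear_pl_function F : locally_linear F -> pl_function F.
Proof.
move=> L e; split; first exact: locally_affine_continuous.
by apply: locally_affine_pl_integral => //; exact: ltW.
Qed.

Lemma admissible_covers (D : {freeg point}) F p :
  admissible D F -> 0 < value D F p -> covers D p.
Proof.
move=> FA vp; have [E [E0 _ dE EF]] := admissible_divisor l_gt0 FA.
exists E; split=> //.
  by exists F => //; apply: locally_linear_pl_function; exact: FA.1.
by rewrite mem_dom -(intr_eq0 R) EF gt_eqF.
Qed.

(** This divisor covers every point, so the minimum defining the gonality is attained and is not the
    junk value 0. *)
Definition vertex_divisor : {freeg point} := \sum_v << inl v >>.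

Lemma coeff_vertex v : coeff (inl v) vertex_divisor = 1.
Proof.
rewrite raddf_sum (bigD1 v) //= coeffU eqxx mulr1 big1 ?addr0 // => u uv.
by rewrite /= coeffU [inl u == _](_ : _ = (u == v)) // (negbTE uv) mulr0.
Qed.

Lemma coeff_interior e (t : R) : 0 < t < l e -> coeff (seg l e t) vertex_divisor = 0.
Proof.
move=> te; rewrite raddf_sum big1 // => u _.
by rewrite /= coeffU (seg_interior te) mulr0.
Qed.

(** On the edge [e0] of length [L] this is the piecewise linear function sending
    the chips of its two ends to the points at distance [m] from them. *)
Definition trapezoid (L m t : R) := Num.max (Num.max (- t) (t - L)) (- m).

Definition edge_trapezoid e0 (m : R) : point -> R := fun p =>
  if p is inr x then
    if (val x).1 == e0 then trapezoid (l e0) m (val x).2 else 0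
  else 0.

Variables (e0 : edge G) (m : R).
Hypotheses (m_gt0 : 0 < m) (m_le : 2 * m <= l e0).
Let L := l e0.
Let F := edge_trapezoid e0 m.

Lemma trapezoid_start t : 0 <= t <= m -> trapezoid L m t = - t.
Proof.
have m0 := m_gt0; have mL : 2 * m <= L := m_le.
move=> tm; rewrite /trapezoid (max_l (_ : t - L <= - t)); last by lra.
by apply: max_l; lra.
Qed.

Lemma trapezoid_end t : L - m <= t <= L -> trapezoid L m t = t - L.
Proof.
have m0 := m_gt0; have mL : 2 * m <= L := m_le.
move=> tm; rewrite /trapezoid (max_r (_ : - t <= t - L)); last by lra.
by apply: max_l; lra.
Qed.

Lemma trapezoid_ge t : [/\ - t <= trapezoid L m t, t - L <= trapezoid L m t
  & - m <= trapezoid L m t].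
Proof. by rewrite /trapezoid !le_max !lexx !orbT. Qed.

Lemma trapezoid_convex t x :
  2 * trapezoid L m t <= trapezoid L m (t + x) + trapezoid L m (t - x).
Proof.
have [p1 p2 p3] := trapezoid_ge (t + x); have [q1 q2 q3] := trapezoid_ge (t - x).
by rewrite {1}/trapezoid /Num.max; case: ifP => _; [|case: ifP => _]; lra.
Qed.

Lemma edge_trapezoidE t : 0 <= t <= L -> F (seg l e0 t) = trapezoid L m t.
Proof.
have m0 := m_gt0; have mL : 2 * m <= L := m_le.
move=> tL; have [->|t0] := eqVneq t 0.
  by rewrite seg0 /= trapezoid_start ?oppr0 // lexx ltW.
have [->|tL'] := eqVneq t L.
  by rewrite (seg_end l_gt0) /= trapezoid_end ?subrr // lexx andbT; lra.
have te : 0 < t < l e0 by rewrite !lt_neqAle eq_sym t0 tL' -/L.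
by rewrite (seg_interior te) /F /= eqxx.
Qed.

Lemma edge_trapezoid0 e t : e != e0 -> F (seg l e t) = 0.
Proof.
move=> ee0; rewrite /seg; case: insubP => //= u _ ue.
by rewrite ue /= (negbTE ee0).
Qed.

Lemma edge_trapezoid_linear : locally_linear F.
Proof.
move=> e; have [->|ee0] := eqVneq e e0; last first.
  apply: (@locally_affine_affine _ _ _ _ 0) => t _.
  by rewrite !edge_trapezoid0 // mul0r addr0.
apply: (@locally_affine_eq _ _ _ (trapezoid L m)) => [t tL|].
  by rewrite edge_trapezoidE.
apply: locally_affine_max; first apply: locally_affine_max.
- by apply: (@locally_affine_affine _ _ _ _ (-1)) => t _; ring.
- by apply: (@locally_affine_affine _ _ _ _ 1) => t _; ring.
- by apply: (@locally_affine_affine _ _ _ _ 0) => t _; ring.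
Qed.

Lemma edge_trapezoid_slope0 e t d : e != e0 -> slope F e t d = 0.
Proof.
move=> ee0; apply: slopeE; exists 1 => // x _.
by rewrite !edge_trapezoid0 // mul0r addr0.
Qed.

Lemma edge_trapezoid_slope_start : slope F e0 0 1 = -1.
Proof.
have m0 := m_gt0; have mL : 2 * m <= L := m_le.
apply: slopeE; exists m => // x xm.
by rewrite !edge_trapezoidE ?trapezoid_start; [ring|lra..].
Qed.

Lemma edge_trapezoid_slope_end : slope F e0 L (-1) = -1.
Proof.
have m0 := m_gt0; have mL : 2 * m <= L := m_le.
apply: slopeE; exists m => // x xm.
by rewrite !edge_trapezoidE ?trapezoid_end; [ring|lra..].
Qed.

(** The slope -1 at each end of [e0] uses up the single chip there, the two ends being distinct; in
    the interior of [e0] convexity gives nonnegativity. *)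
Lemma edge_trapezoid_admissible : admissible vertex_divisor F.
Proof.
split; first exact: edge_trapezoid_linear.
move=> p; case: (seg_cover p) => [[v ->]|[e [t [te ->]]]].
  rewrite /value coeff_vertex /=.
  have -> : \sum_(e | esrc e == v) slope F e 0 1 = - (esrc e0 == v)%:R.
    rewrite big_mkcond (bigD1 e0) //= big1 ?addr0.
      by rewrite edge_trapezoid_slope_start; case: eqP; rewrite ?oppr0.
    by move=> e ee0; rewrite edge_trapezoid_slope0 // if_same.
  have -> : \sum_(e | etgt e == v) slope F e (l e) (-1) = - (etgt e0 == v)%:R.
    rewrite big_mkcond (bigD1 e0) //= big1 ?addr0.
      by rewrite edge_trapezoid_slope_end; case: eqP; rewrite ?oppr0.
    by move=> e ee0; rewrite edge_trapezoid_slope0 // if_same.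
  have := loopless e0.
  by have [sv|sv] := eqVneq (esrc e0) v; have [tv|tv] := eqVneq (etgt e0) v;
    rewrite ?sv ?tv ?eqxx //= => _; lra.
rewrite /value (coeff_interior te) add0r (seg_interior te) /=.
have [ee0|ee0] := eqVneq e e0; last by rewrite !edge_trapezoid_slope0 // addr0.
rewrite {}ee0 in te *.
have [|k1 -> A1] := locally_linear_dir edge_trapezoid_linear (e := e0) (t := t) (d := 1).
  by left; split=> //; lra.
have [|k2 -> A2] := locally_linear_dir edge_trapezoid_linear (e := e0) (t := t) (d := -1).
  by right; split=> //; lra.
have [|x xm xE] := affine_at_second_difference A1 A2 (r := Num.min t (L - t)).
  by rewrite lt_min subr_gt0.
move: xm; rewrite le_min => /and3P[x0 xt xL].
rewrite -(pmulr_lge0 _ x0) -xE !edge_trapezoidE; [|lra..].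
by have := trapezoid_convex t x; lra.
Qed.

(** At a corner the function rises with slope 1 towards the nearer end and is at least [- m] on the
    other side, so the second difference is positive, even when [2 * m = L] merges the corners. *)
Lemma edge_trapezoid_value t :
  t = m \/ t = L - m -> 0 < value vertex_divisor F (seg l e0 t).
Proof.
have m0 := m_gt0; have mL : 2 * m <= L := m_le.
move=> tm; have te : 0 < t < l e0 by rewrite -/L; case: tm => ->; lra.
rewrite /value (coeff_interior te) add0r (seg_interior te) /=.
have [|k1 -> A1] := locally_linear_dir edge_trapezoid_linear (e := e0) (t := t) (d := 1).
  by left; split=> //; lra.
have [|k2 -> A2] := locally_linear_dir edge_trapezoid_linear (e := e0) (t := t) (d := -1).
  by right; split=> //; lra.
have [|x xm xE] := affine_at_second_difference A1 A2 (r := m) => //.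
case/andP: xm => x0 xm.
rewrite -(pmulr_lgt0 _ x0) -xE.
have [_ _ h1] := trapezoid_ge (t + x); have [_ _ h2] := trapezoid_ge (t - x).
case: tm => tE; rewrite {}tE in te A1 A2 xE h1 h2 *.
  rewrite !edge_trapezoidE; [|lra..].
  have Tm : trapezoid L m m = - m by apply: trapezoid_start; lra.
  have Tx : trapezoid L m (m - x) = - (m - x) by apply: trapezoid_start; lra.
  by rewrite Tm Tx; lra.
rewrite !edge_trapezoidE; [|lra..].
have Tm : trapezoid L m (L - m) = - m by rewrite trapezoid_end; lra.
have Tx : trapezoid L m (L - m + x) = - m + x by rewrite trapezoid_end; lra.
by rewrite Tm Tx; lra.
Qed.

End GonalityAttained.

Lemma minimumP (A : set int) : (exists x, A x) -> (forall x, A x -> 0 <= x) ->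
  A (minimum A) /\ forall x, A x -> minimum A <= x.
Proof.
move=> [x0 Ax0] A0.
have ex : exists n, `[< A (Posz n) >].
  by exists `|x0|%N; apply/asboolP; rewrite gez0_abs ?A0.
apply: (@xgetPex _ 0 [set x | A x /\ (forall y, A y -> x <= y)]%classic).
exists (Posz (ex_minn ex)); case: ex_minnP => n /asboolP An nmin; split=> // y Ay.
by rewrite -[y]gez0_abs ?A0 // lez_nat nmin //; apply/asboolP; rewrite gez0_abs ?A0.
Qed.

(** * Comparison of treewidth with the degree of a covering divisor *)

Section Treewidth.
Context (R : realType) (G : multigraph) (l : edge G -> R).
Hypothesis l_gt0 : forall e, 0 < l e.
Local Notation point := (mgpoint l).

(** The zero function covers the vertices. For an interior point, the trapezoid is taken with [m]
    the distance to the nearer end, so that [2 * m] is at most the length. *)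
Lemma vertex_divisor_covers (p : point) : covers (vertex_divisor l) p.
Proof.
case: (seg_cover p) => [[v ->]|[e [t [te ->]]]].
  apply: (@admissible_covers _ _ _ l_gt0 _ (fun=> 0)); last first.
    rewrite /value coeff_vertex sum_outgoing_slopesE big1 ?addr0 ?ltr01 // => x _.
    by apply: slopeE; exists 1 => // y _; rewrite mul0r addr0.
  have L0 : locally_linear (fun _ : point => 0 : R).
    by move=> e; apply: (@locally_affine_affine _ _ _ _ 0) => t _; rewrite mul0r addr0.
  split=> // q; rewrite /value sum_outgoing_slopesE big1 ?addr0; last first.
    by move=> x _; apply: slopeE; exists 1 => // y _; rewrite mul0r addr0.
  case: (seg_cover q) => [[u ->]|[e [t [te ->]]]]; first by rewrite coeff_vertex.
  by rewrite coeff_interior.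
have [tl|tl] := leP (2 * t) (l e).
  apply: (@admissible_covers _ _ _ l_gt0 _ (edge_trapezoid e t)).
    by apply: edge_trapezoid_admissible => //; case/andP: te.
  by apply: edge_trapezoid_value => //; [case/andP: te|left].
have m0 : 0 < l e - t by lra.
have m1 : 2 * (l e - t) <= l e by lra.
apply: (@admissible_covers _ _ _ l_gt0 _ (edge_trapezoid e (l e - t))).
  exact: edge_trapezoid_admissible.
by apply: edge_trapezoid_value => //; right; rewrite subKr.
Qed.

(** The pursuit is run on the chips of admissible functions, with [k] the degree of [D].
    Nonnegativity of the degree, read off from one admissible function, is what bounds below the set
    whose minimum is the gonality. *)
Lemma treewidth_le_degree (D : {freeg point}) :
  (forall p, covers D p) -> 0 <= deg D /\ treewidth G <= deg D.
Proof.
move=> cov; pose state c := exists2 F, admissible D F & c = chips D F.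
have [v _] : exists v, v \in vertex G by apply/card_gt0P; exact: vertex_nonempty.
have [F FA _] := covers_admissible (cov (inl v)).
have degD : 0 <= deg D by apply: le_trans (chips_card l_gt0 FA).
split=> //.
have card c : state c -> (#|c.1| + #|c.2| <= `|deg D|)%N.
  by move=> [g gA ->]; rewrite -lez_nat gez0_abs ?chips_card.
have move c C phi : state c -> C != finset.set0 -> c.1 :&: C = finset.set0 ->
    labelling phi -> guards c (edge_cut C) phi -> _ :=
  @chips_move _ _ _ l_gt0 D c C phi (fun u => cov (inl u)).
have [H HG omega] := pursuit_chordal_extension card move (ex_intro2 _ _ F FA erefl).
have [||_ min] := @minimumP [set k | exists2 H : simple_graph (vertex G),
  chordal_extension H & k = (clique_number H)%:Z]%classic.
- by exists (clique_number H)%:Z; exists H.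
- by move=> _ [K _ ->].
rewrite /treewidth addrC lerBlDr; apply: le_trans (min (clique_number H)%:Z _) _.
  by exists H.
by rewrite -[deg D]gez0_abs // -PoszD addn1 lez_nat.
Qed.

End Treewidth.

Theorem corollary4p2 (R : realType) (G : multigraph) (G_conn : connected_graph G)
    (l : edge G -> R) (l_gt0 : forall e : edge G, 0 < l e) :
  treewidth G <= gonality l.
Proof.
have [||[D Dcov gonD] _] := @minimumP [set k | exists2 D : {freeg mgpoint l},
  (forall s, covers D s) & k = deg D]%classic.
- exists (deg (vertex_divisor l)); exists (vertex_divisor l) => // p.
  exact: vertex_divisor_covers.
- by move=> _ [D /(treewidth_le_degree l_gt0)[D0 _] ->].
rewrite /gonality gonD; exact: (treewidth_le_degree l_gt0 Dcov).2.
Qed.
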